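(* Assume that $|f(t,u)|\le M$ and $|f(t,u_1)-f(t,u_2)|\le K|u_1-u_2|$ for all $t\in[0,T]$ and $u,u_1,u_2\in D$, that the set $D_\beta$ is non-empty, that $u_0(t,\chi_1)\in D$ for $t\in[0,T]$, $\chi_1\in\Omega$, and that $r(Q)<1$. Let $\chi_1^*\in\Omega$. Then $u_\infty(\cdot,\chi_1^* )$ is a solution of the boundary value problem $${}^C_0D^p_tu(t)=f(t,u(t)),\quad t\in[0,T],\qquad u(0)=\alpha_1,\quad u(T)=\alpha_2,$$ if and only if $\chi_1^*$ is a solution of the determining equation $$\Delta(\chi_1^* )=0 .$$
   Context: Fix $n\ge1$, $T>0$, $p\in(1,2]$, a closed and bounded domain $D\subset\mathbb R^n$, a continuous function $f:[0,T]\times D\to\mathbb R^n$, vectors $\alpha_1,\alpha_2\in\mathbb R^n$, a set $\Omega\subset\mathbb R^n$, a vector $M\in\mathbb R^n$ and a real $n\times n$ matrix $K$ with non-negative entries. The operations $|\cdot|$, $\le$, $=$, $\max$, $\sup$ on vectors and matrices are componentwise. $\Gamma$ is the Gamma function, $r(\cdot)$ the spectral radius. Solutions are continuous functions $u:[0,T]\to D$. ${}^C_0D^p_t$ is the Caputo fractional derivative of order $p$ with lower limit $0$: for $u\in C^1([0,T],\mathbb R^n)$, ${}^C_0D^p_tu(t)=\frac{d^2}{dt^2}\frac1{\Gamma(2-p)}\int_0^t(t-s)^{1-p}\,[u(s)-u(0)-u'(0)s]\,ds$ if $p<2$, and ${}^C_0D^2_tu=u''$ (for $u\in C^2$, $p<2$,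 this equals $\frac1{\Gamma(2-p)}\int_0^t(t-s)^{1-p}u''(s)\,ds$). Put $\beta=\frac{MT^p}{2^{2p-1}\Gamma(p+1)}$, $Q=\frac{KT^p}{2^{2p-1}\Gamma(p+1)}$, and $D_\beta=\{\chi_0\in D:\{u\in\mathbb R^n:|u-\chi_0|\le\beta\}\subset D\}$, where $\chi_0$ stands for the initial value $u(0)$. For $\chi_1\in\Omega$, $t\in[0,T]$, define $u_0(t,\chi_1)=\alpha_1+\chi_1t+(\alpha_2-\alpha_1-\chi_1T)(t/T)^p$ and, for $m\ge1$, $$u_m(t,\chi_1)=u_0(t,\chi_1)+\frac1{\Gamma(p)}\Big[\int_0^t(t-s)^{p-1}f(s,u_{m-1}(s,\chi_1))ds-\Big(\frac tT\Big)^p\int_0^T(T-s)^{p-1}f(s,u_{m-1}(s,\chi_1))ds\Big].$$ $u_\infty(\cdot,\chi_1)$ denotes the uniform limit on $[0,T]$ of $u_m(\cdot,\chi_1)$ as $m\to\infty$, and $$\Delta(\chi_1)=\frac{(\alpha_2-\alpha_1-\chi_1T)\Gamma(p+1)}{T^p}-\frac p{T^p}\int_0^T(T-s)^{p-1}f(s,u_\infty(s,\chi_1))\,ds .$$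
   Formalization: It is additionally assumed that all approximations u_m(t,χ₁* ) lie in D for t in [0,T]; since f is given only on [0,T]×D, u_m is otherwise undefined, and non-emptiness of D_β with u_0 in D does not ensure this. *)

(* Defs.v *)
From HB Require Import structures.
From mathcomp Require Import all_boot all_order all_algebra.
From mathcomp Require Import complex.
From mathcomp Require Import all_classical all_reals all_analysis.

Set Implicit Arguments.
Unset Strict Implicit.
Unset Printing Implicit Defensive.

Import Order.TTheory GRing.Theory Num.Theory.
Import numFieldNormedType.Exports.

Local Open Scope classical_set_scope.
Local Open Scope ring_scope.

Definition mxle (R : realType) (m n : nat) (A B : 'M[R]_(m, n)) : Prop :=
  forall i j, A i j <= B i j.

Definition mxabs (R : realType) (m n : nat) (A : 'M[R]_(m, n)) :
  'M[R]_(m, n) := \matrix_(i, j) `|A i j|.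

(* The eigenvalues are the complex ones: A is mapped into matrices over R[i].
   For n >= 1 the set of moduli is finite and nonempty, so sup is a maximum. *)
Definition spectral_radius (R : realType) (n : nat) (A : 'M[R]_n) : R :=
  sup [set ComplexField.Normc.normc z |
        z in [set z | eigenvalue (map_mx (real_complex R) A) z]].

Definition Gamma_fun (R : realType) (x : R) : R :=
  \int[lebesgue_measure]_(t in `]0, +oo[%classic) (t `^ (x - 1) * expR (- t)).

Definition vint (R : realType) (n : nat) (A : set R) (g : R -> 'cV[R]_n) :
  'cV[R]_n := \col_i \int[lebesgue_measure]_(s in A) (g s i 0).

Section Caputo.
Variables (R : realType) (p T : R).

(* x is differentiable at t with derivative l, relatively to [0, T]: the
   derivative is one-sided at the end points 0 and T. *)
Definition has_deriv (x : R -> R) (t l : R) : Prop :=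
  (x s - x t) / (s - t) @[s --> within `[0, T]%classic t^'] --> l.

Definition deriv_on (x x' : R -> R) : Prop :=
  forall t, 0 <= t <= T -> has_deriv x t (x' t).

(* The function whose second derivative is the Caputo derivative of x for
   p < 2; x0' is the value at 0 of the derivative of x. *)
Definition caputo_primitive (x : R -> R) (x0' t : R) : R :=
  (Gamma_fun (2 - p))^-1 *
    \int[lebesgue_measure]_(s in `[0, t]%classic)
      ((t - s) `^ (1 - p) * (x s - x 0 - x0' * s)).

(* x is of class C^1 on [0, T], its Caputo derivative of order p in ]1, 2]
   exists on the whole of [0, T] and is equal to y there. *)
Definition has_caputo (x y : R -> R) : Prop :=
  exists x' : R -> R,
    [/\ deriv_on x x',
        {within `[0, T], continuous x'} &
        if p < 2 then
          exists2 z : R -> R,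
            deriv_on (caputo_primitive x (x' 0)) z & deriv_on z y
        else deriv_on x' y].

End Caputo.

Section Dirichlet.
Variables (R : realType) (n : nat) (p T : R).
(* f is meant as a function on [0, T] x D; its values elsewhere are junk. *)
Variables (f : R -> 'cV[R]_n -> 'cV[R]_n) (alpha1 alpha2 : 'cV[R]_n).

Definition bvp_solution (D : set 'cV[R]_n) (u : R -> 'cV[R]_n) : Prop :=
  [/\ {within `[0, T], continuous u},
      forall t, 0 <= t <= T -> D (u t),
      forall i, has_caputo p T (fun t => u t i 0) (fun t => f t (u t) i 0),
      u 0 = alpha1 & u T = alpha2].

Definition kernel_const : R := T `^ p / (2 `^ (2 * p - 1) * Gamma_fun (p + 1)).

Definition beta_vec (M : 'cV[R]_n) : 'cV[R]_n := kernel_const *: M.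

Definition Qmx (K : 'M[R]_n) : 'M[R]_n := kernel_const *: K.

Definition Dbeta (D : set 'cV[R]_n) (b : 'cV[R]_n) : set 'cV[R]_n :=
  [set chi0 | D chi0 /\ [set u | mxle (mxabs (u - chi0)) b] `<=` D].

Definition u0 (t : R) (chi1 : 'cV[R]_n) : 'cV[R]_n :=
  alpha1 + t *: chi1 + ((t / T) `^ p) *: (alpha2 - alpha1 - T *: chi1).

Fixpoint u_iter (m : nat) (t : R) (chi1 : 'cV[R]_n) : 'cV[R]_n :=
  if m is m'.+1 then
    u0 t chi1 + (Gamma_fun p)^-1 *:
      (vint `[0, t]%classic
         (fun s => ((t - s) `^ (p - 1)) *: f s (u_iter m' s chi1))
       - ((t / T) `^ p) *:
         vint `[0, T]%classic
           (fun s => ((T - s) `^ (p - 1)) *: f s (u_iter m' s chi1)))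
  else u0 t chi1.

(* The limit of the approximations for the uniform convergence on [0, T]. It is
   selected by get, as in the library's lim, which is not available on the
   type of functions with the topology of uniform convergence on a set. *)
Definition u_inf (t : R) (chi1 : 'cV[R]_n) : 'cV[R]_n :=
  (get [set v : R -> 'cV[R]_n |
     {uniform `[0, T]%classic,
        (fun m s => u_iter m s chi1) @ \oo --> v}]) t.

Definition Delta_det (chi1 : 'cV[R]_n) : 'cV[R]_n :=
  (Gamma_fun (p + 1) / T `^ p) *: (alpha2 - alpha1 - T *: chi1)
  - (p / T `^ p) *:
    vint `[0, T]%classic
      (fun s => ((T - s) `^ (p - 1)) *: f s (u_inf s chi1)).

End Dirichlet.

(* Main.v *)
(* Write G(t, s) = (t - s)_+^(p-1) - (t/T)^p (T - s)^(p-1) for the kernel of the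
   correction added to u_0, and tau = t/T.

   Convergence of the approximations. The uniform norm of the integral operator
   with kernel |G| exceeds the constant T^p / (2^(2p-1) p) for p = 2, so the
   increments are measured against a weight w instead. Concavity of
   x |-> x^(p-1) gives
   (T - s)^(p-1) >= (1 - tau) T^(p-1) + tau (T (t - s) / t)^(p-1), hence
   int s G(t, s)^2 ds <= t V(t) for an explicit V, and, as 2^(p-1) <= p,
   int_0^T V <= c^2 where c = T^p / (2^(2p-1) p). With w(t)^2 = t V(t), the
   AM-GM inequality turns this into |int G(t, s) g(s) ds| <= k c w(t) whenever
   |g| <= k w. As Q >= 0 and r(Q) < 1, there are v > 0 and theta < 1 with
   Q v <= theta v, so that |u_(m+2) - u_(m+1)| <= C theta^m w(t) v.

   Equivalence. Since the fractional integral of 1 is t^p / Gamma(p+1), the fixed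
   point equation of u = u_oo reads u = alpha_1 + chi_1 t + I^p (f(., u) + Delta),
   where I^p is the fractional integral of order p. By the semigroup property of
   fractional integrals the Caputo derivative of u is f(., u) + Delta, and
   derivatives are unique; the boundary values hold in any case. *)

(* The weight comes from a Hilbert-Schmidt norm. On L^2([0, T], dt/t) the operator with kernel G has
   as squared Hilbert-Schmidt norm the double integral of s G(t, s)^2 ds dt/t, which is at most the
   integral of V. The Cauchy-Schwarz inequality behind that norm, applied at a fixed t, bounds the
   image pointwise by a multiple of w(t), and a pointwise bound is what uniform convergence needs.
   The measure matters: for p = 2 the squared norm with respect to dt is T^4/180, above c^2 =
   T^4/256, whereas with respect to dt/t it is T^4/360.

   The vector v merges the n coordinates into one weighted norm, so that every step contracts with
   the same ratio theta.

   [Gamma_fun] and the fractional integrals are real-valued integrals, which are 0 by default when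
   the extended integral is infinite. The identities between them are therefore first proved in
   [0, +oo], by Tonelli's theorem for convolutions of truncated powers; finiteness is established
   separately. *)
Require Import Defs.
From mathcomp Require Import all_boot all_order all_algebra.
From mathcomp Require Import complex ring lra.
From mathcomp Require Import all_classical all_reals all_analysis measurable_realfun.
Set Implicit Arguments.
Unset Strict Implicit.
Unset Printing Implicit Defensive.
Import Order.TTheory GRing.Theory Num.Theory.
Import numFieldNormedType.Exports.
Local Open Scope classical_set_scope.
Local Open Scope ring_scope.

(** * Convolution of nonnegative functions on the line *)

Section convolution.
Local Open Scope ereal_scope.
Variable R : realType.
Notation mu := (@lebesgue_measure R).
Implicit Types f g h : R -> \bar R.

(** By uniqueness of Lebesgue measure it is enough to compare both sides on the intervals []a,
    b]]. *)
Lemma lebesgue_measure_affine (c d : R) : (0 < c)%R -> forall A : set R,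
  measurable A ->
  mu A = c%:E * pushforward mu (fun x : measurableTypeR R => c * x + d : measurableTypeR R)%R A.
Proof.
move=> c0 A mA.
have mphi : measurable_fun [set: measurableTypeR R]
    (fun x : measurableTypeR R => c * x + d : measurableTypeR R)%R.
  by apply: measurable_funD => //; apply: measurable_funM.
pose nu : {measure set (measurableTypeR R) -> \bar R} :=
  measure_function_pushforward__canonical__measure_function_Measure mu mphi.
rewrite -[RHS]/(mscale (NngNum (ltW c0)) nu A).
apply: lebesgue_measure_unique => //= _ [[a b]] _ <-.
rewrite /mscale /= /pushforward.
rewrite (_ : (fun x : R => c * x + d)%R @^-1` [set` `]a, b]] = [set` `]((a - d) / c)%R, ((b - d) / c)%R]]).
  rewrite !lebesgue_measure_itv/= !lte_fin ltr_pM2r ?invr_gt0// ltrD2r.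
  case: ifPn => _; last by rewrite mule0.
  rewrite -!EFinB -EFinM; congr EFin.
  by rewrite -mulrBl mulrCA divff ?gt_eqF// mulr1 opprB addrA subrK.
apply/seteqP; split => x /=; rewrite !in_itv/= ltr_pdivrMr// ler_pdivlMr//.
  by rewrite ltrBlDr lerBrDr [(x * c)%R]mulrC.
by rewrite ltrBlDr lerBrDr [(x * c)%R]mulrC.
Qed.

Lemma ge0_integral_affine (c d : R) f : (0 < c)%R ->
  measurable_fun [set: R] f -> (forall x, 0 <= f x) ->
  \int[mu]_x f x = c%:E * \int[mu]_x f (c * x + d)%R.
Proof.
move=> c0 mf f0.
have mphi : measurable_fun [set: measurableTypeR R]
    (fun x : measurableTypeR R => c * x + d : measurableTypeR R)%R.
  by apply: measurable_funD => //; apply: measurable_funM.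
pose nu : {measure set (measurableTypeR R) -> \bar R} :=
  measure_function_pushforward__canonical__measure_function_Measure mu mphi.
transitivity (\int[mscale (NngNum (ltW c0)) nu]_x f x).
  by apply: eq_measure_integral => //= A mA _; exact: lebesgue_measure_affine.
rewrite ge0_integral_mscale//; congr (_ * _).
exact: (@ge0_integral_pushforward _ _ _ _ R _ mphi).
Qed.

Lemma ge0_integral_shift (d : R) f :
  measurable_fun [set: R] f -> (forall x, 0 <= f x) ->
  \int[mu]_x f (x - d)%R = \int[mu]_x f x.
Proof.
move=> mf f0; rewrite [RHS](@ge0_integral_affine 1 (- d)%R)// mul1e.
by under [RHS]eq_integral do rewrite mul1r.
Qed.

(** Values are taken in the extended reals: for nonnegative arguments Tonelli's theorem then applies
    without integrability conditions. *)
Definition convolution f g (t : R) : \bar R := \int[mu]_s (f (t - s)%R * g s).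

Let mconv_integrand f g : measurable_fun [set: R] f -> measurable_fun [set: R] g ->
  measurable_fun [set: R * R] (fun z : R * R => f (z.1 - z.2)%R * g z.2).
Proof.
move=> mf mg; apply: emeasurable_funM.
  by apply: (measurableT_comp mf); apply: measurable_funB.
exact: (measurableT_comp mg).
Qed.

Lemma convolution_ge0 f g t : (forall x, 0 <= f x) -> (forall x, 0 <= g x) ->
  0 <= convolution f g t.
Proof. by move=> f0 g0; apply: integral_ge0 => s _; rewrite mule_ge0. Qed.

(** After Tonelli's exchange of the two integrals, the translation of s by r in the inner one
    recombines [f] and [g]. *)
Lemma convolutionA f g h t :
  measurable_fun [set: R] f -> measurable_fun [set: R] g ->
  measurable_fun [set: R] h ->
  (forall x, 0 <= f x) -> (forall x, 0 <= g x) -> (forall x, 0 <= h x) ->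
  convolution f (convolution g h) t = convolution (convolution f g) h t.
Proof.
move=> mf mg mh f0 g0 h0.
have msub (c : R) : measurable_fun [set: R] (fun s : R => c - s)%R.
  by apply: measurable_funB.
have msub2 (c : R) : measurable_fun [set: R] (fun s : R => s - c)%R.
  by apply: measurable_funB.
have -> : convolution f (convolution g h) t =
    \int[mu]_s \int[mu]_r (f (t - s)%R * (g (s - r)%R * h r)).
  apply: eq_integral => s _; rewrite -ge0_integralZl//=.
  - apply: emeasurable_funM => //.
    exact: (measurableT_comp mg (msub _)).
  - by move=> r _; rewrite mule_ge0.
rewrite (@fubini_tonelli _ _ _ _ _ mu mu
  (fun z : R * R => f (t - z.1)%R * (g (z.1 - z.2)%R * h z.2))) /=; last 2 first.
- apply: emeasurable_funM; last exact: mconv_integrand.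
  by apply: (measurableT_comp mf); apply: measurable_funB.
- by move=> z; rewrite !mule_ge0.
apply: eq_integral => r _; rewrite muleC.
under eq_integral do rewrite muleA muleC.
rewrite ge0_integralZl//=; last 2 first.
- apply: emeasurable_funM => //.
  + exact: (measurableT_comp mf (msub _)).
  + exact: (measurableT_comp mg (msub2 _)).
- by move=> s _; rewrite mule_ge0.
congr (_ * _); rewrite /convolution.
rewrite -(@ge0_integral_shift r (fun s => f (t - r - s)%R * g s)).
- by apply: eq_integral => s _; rewrite opprB addrA subrK.
- apply: emeasurable_funM => //.
  exact: (measurableT_comp mf (msub _)).
- by move=> s; rewrite mule_ge0.
Qed.

End convolution.

(** * Truncated powers and the Beta and Gamma functions *)

Section power_kernel.
Local Open Scope ereal_scope.
Variable R : realType.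
Notation mu := (@lebesgue_measure R).
Implicit Types a b t : R.

(** Tonelli's theorem and translation invariance. With exponentially damped powers for [f] and [g]
    this becomes the product formula for Gamma. *)
Lemma ge0_integral_convolution (f g : R -> \bar R) :
  measurable_fun [set: R] f -> measurable_fun [set: R] g ->
  (forall x, 0 <= f x) -> (forall x, 0 <= g x) ->
  \int[mu]_t convolution f g t = \int[mu]_t f t * \int[mu]_t g t.
Proof.
move=> mf mg f0 g0; rewrite /convolution.
have mfs s : measurable_fun [set: R] (fun t : R => f (t - s)%R).
  by apply: (measurableT_comp mf); apply: measurable_funB.
rewrite (@fubini_tonelli _ _ _ _ _ mu mu
  (fun z : R * R => f (z.1 - z.2)%R * g z.2)) /=; last 2 first.
- apply: emeasurable_funM; last exact: (measurableT_comp mg).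
  by apply: (measurableT_comp mf); apply: measurable_funB.
- by move=> z; rewrite mule_ge0.
rewrite -ge0_integralZl//=; last by apply: integral_ge0.
apply: eq_integral => s _; rewrite ge0_integralZr//; last exact: mfs.
by rewrite ge0_integral_shift.
Qed.

(** The truncated power t_+^(a-1), set to 0 at the origin as well, so that the conventions for
    powers of zero and of negative numbers never enter. *)
Definition power_kernel a t : \bar R := (if 0 < t then t `^ (a - 1) else 0)%R%:E.

Lemma power_kernel_ge0 a t : 0 <= power_kernel a t.
Proof. by rewrite lee_fin; case: ifP => // _; exact: powR_ge0. Qed.

Lemma measurable_power_kernel a : measurable_fun [set: R] (power_kernel a).
Proof.
apply/measurable_EFinP; apply: measurable_fun_ifT => //.
exact: measurable_fun_ltr.
Qed.

Lemma power_kernelM a t x : (0 < t)%R ->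
  power_kernel a (t * x) = (t `^ (a - 1))%:E * power_kernel a x.
Proof.
move=> t0; rewrite /power_kernel -EFinM; congr EFin.
rewrite pmulr_rgt0//; case: ifPn => x0; last by rewrite mulr0.
by rewrite powRM// ltW.
Qed.

(** Euler's Beta function: the truncations restrict the convolution at 1 to the integral of (1 -
    s)^(a-1) s^(b-1) over ]0, 1[. *)
Definition ebeta a b := convolution (power_kernel a) (power_kernel b) 1%R.

Lemma ebeta_ge0 a b : 0 <= ebeta a b.
Proof. by apply: convolution_ge0 => x; exact: power_kernel_ge0. Qed.

(** Homogeneity: the substitution s = t x takes out the factor t t^(a-1) t^(b-1) and leaves the Beta
    integral. For t <= 0 the supports of the two factors do not meet. *)
Lemma convolution_power_kernel a b t :
  convolution (power_kernel a) (power_kernel b) t =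
  ebeta a b * power_kernel (a + b) t.
Proof.
have mk c : measurable_fun [set: R] (power_kernel c) by exact: measurable_power_kernel.
have k0 c x : 0 <= power_kernel c x by exact: power_kernel_ge0.
have msub (c : R) : measurable_fun [set: R] (fun s : R => c - s)%R.
  by apply: measurable_funB.
have [t0|t0] := ltP 0%R t; last first.
  rewrite [power_kernel (a + b) t]/power_kernel ltNge t0/= mule0.
  apply: integral0_eq => s _; rewrite /power_kernel subr_gt0.
  case: ifPn => st; last by rewrite mul0e.
  by rewrite [X in if X then _ else _]ltNge (le_trans (ltW st) t0)/= mule0.
rewrite /convolution (@ge0_integral_affine _ t 0%R)//; last 2 first.
- apply: emeasurable_funM; last exact: mk.
  exact: (measurableT_comp (mk _) (msub _)).
- by move=> x; rewrite mule_ge0.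
under eq_integral => x _.
  rewrite addr0 (_ : t - t * x = t * (1 - x))%R; last by rewrite mulrBr mulr1.
  rewrite !power_kernelM// muleACA.
  over.
rewrite ge0_integralZl//=; last 3 first.
- apply: emeasurable_funM; last exact: mk.
  exact: (measurableT_comp (mk _) (msub _)).
- by move=> x _; rewrite mule_ge0.
- by rewrite -EFinM lee_fin mulr_ge0// powR_ge0.
rewrite muleA muleC; congr (_ * _).
rewrite /power_kernel t0 -!EFinM; congr EFin.
have tD r s : (t `^ (r + s) = t `^ r * t `^ s)%R by rewrite powRD// (gt_eqF t0) implybT.
rewrite -[X in (X * _)%R](powRr1 (ltW t0)) -!tD.
by congr powR; lra.
Qed.

(** Euler's integral before [fine] is applied; its identities pass to [Gamma_fun] once it is known
    to be finite. *)
Definition eGamma a := \int[mu]_t (power_kernel a t * (expR (- t))%:E).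

Let mexpN : measurable_fun [set: R] (fun t : R => (expR (- t))%:E).
Proof. by apply/measurable_EFinP; apply: measurableT_comp => //. Qed.

Let mgam a : measurable_fun [set: R] (fun t : R => power_kernel a t * (expR (- t))%:E).
Proof. apply: emeasurable_funM => //; exact: measurable_power_kernel. Qed.

Let gam_ge0 a t : 0 <= power_kernel a t * (expR (- t))%:E.
Proof. by rewrite mule_ge0// ?power_kernel_ge0// lee_fin expR_ge0. Qed.

(** The exponentials in the convolution of t_+^(a-1) e^(-t) and t_+^(b-1) e^(-t) multiply to e^(-t),
    so it equals B(a, b) t_+^(a+b-1) e^(-t). Total masses are then compared. *)
Lemma eGammaM a b : eGamma a * eGamma b = ebeta a b * eGamma (a + b).
Proof.
have mk c : measurable_fun [set: R] (power_kernel c) by exact: measurable_power_kernel.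
have k0 c x : 0 <= power_kernel c x by exact: power_kernel_ge0.
rewrite /eGamma -ge0_integral_convolution//.
rewrite -(@ge0_integralZl _ _ _ mu setT measurableT _ (mgam (a + b)))//; last exact: ebeta_ge0.
apply: eq_integral => t _; rewrite muleA -convolution_power_kernel.
have mc : measurable_fun [set: R] (fun s : R => power_kernel a (t - s)%R * power_kernel b s).
  apply: emeasurable_funM; last exact: mk.
  by apply: (measurableT_comp (mk a)); apply: measurable_funB.
rewrite -(@ge0_integralZr _ _ _ mu setT measurableT _ mc)//; last first.
  by move=> s _; rewrite mule_ge0.
apply: eq_integral => s _; rewrite muleACA; congr (_ * _).
by rewrite -EFinM -expRD; congr (expR _)%:E; lra.
Qed.

Lemma Gamma_funE a : Gamma_fun a = fine (eGamma a).
Proof.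
rewrite /Gamma_fun /Rintegral integral_mkcond; congr fine.
apply: eq_integral => t _; rewrite patchE /power_kernel mem_setE in_itv/= andbT.
by case: ifPn => // _; rewrite mul0e.
Qed.

(** Away from 0 the integrand is the density of the exponential law of rate 1. *)
Lemma eGamma1 : eGamma 1 = 1.
Proof.
rewrite -(@integral_exponential_pdf R 1%R ltr01) /eGamma.
apply: ae_eq_integral => //.
- exact: mgam.
- apply/measurable_EFinP; exact: measurable_exponential_pdf.
- exists [set 0%R]; split; [exact: measurable_set1|exact: lebesgue_measure_set1|].
  move=> x /= xN; apply: contrapT => x0; apply: xN => _.
  rewrite /power_kernel /exponential_pdf patchE mem_setE in_itv/= andbT subrr powRr0.
  rewrite lt_neqAle; case: eqP => [x00|_] /=; first by case: x0.
  case: ifPn => _; last by rewrite mul0e.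
  by rewrite mul1e mul1r mulN1r.
Qed.

(** For b < 1 the integrand is unbounded at 0. The fundamental theorem is therefore applied away
    from 0, and monotone convergence exhausts the interval. *)
Lemma ebeta1 b : (0 < b)%R -> ebeta 1 b = b^-1%:E.
Proof.
move=> b0.
(* The shift by 2 keeps the left end point strictly below 1, as the fundamental theorem requires. *)
pose F (i : nat) := [set` `[(i.+2%:R^-1 : R)%R, 1%R]].
have i2 (i : nat) : (0 < i.+2%:R^-1 :> R)%R by rewrite invr_gt0.
have mpow (A : set R) : measurable_fun A (fun s : R => (s `^ (b - 1))%:E).
  by apply: measurable_funTS; apply/measurable_EFinP; exact: measurable_powR.
have -> : ebeta 1 b = \int[mu]_(s in `]0%R, 1%R[) (s `^ (b - 1))%:E.
  rewrite [RHS]integral_mkcond; apply: eq_integral => s _.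
  rewrite patchE mem_setE in_itv/= /power_kernel subr_gt0 subrr powRr0.
  case: ifPn => s1; last by rewrite mul0e andbF.
  by rewrite mul1e andbT; case: ifPn.
rewrite integral_itv_bndo_bndc//.
have -> : [set` `]0%R, 1%R]] = \bigcup_i F i.
  apply/seteqP; split => x /=; rewrite in_itv/=.
    move=> /andP[x0 x1]; exists (Num.truncn x^-1) => //=.
    rewrite /F/= in_itv/= x1 andbT invf_ple ?posrE// ltW//.
    by rewrite (lt_trans (truncnS_gt _))// ltr_nat.
  by move=> [i _]; rewrite /F/= in_itv/= => /andP[ix ->]; rewrite andbT (lt_le_trans (i2 i)).
have cvgF : \int[mu]_(x in F i) (x `^ (b - 1))%:E @[i --> \oo] -->
    \int[mu]_(x in \bigcup_i F i) (x `^ (b - 1))%:E.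
  apply: ge0_nondecreasing_set_cvg_integral => //.
  - move=> m n mn; apply/subsetPset => x; rewrite /F/= !in_itv/= => /andP[mx ->].
    rewrite andbT (le_trans _ mx)// lef_pV2 ?posrE//.
    by rewrite ler_nat.
  - by move=> i; exact: measurable_itv.
  - by move=> i; exact: mpow.
  - by move=> i x _; rewrite lee_fin powR_ge0.
have FE i : \int[mu]_(x in F i) (x `^ (b - 1))%:E =
    (b^-1 - (i.+2%:R^-1) `^ b / b)%:E.
  have dpow (x : R) : (0 < x)%R ->
      is_derive x (1%R : R) (fun y : R => (y `^ b / b)%R : R) (x `^ (b - 1))%R.
    move=> x0; have := is_derive1_powR b x0 => dx.
    apply: is_derive_eq.
    by rewrite scaler0 add0r /GRing.scale/= mulrA mulVf ?mul1r// gt_eqF.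
  have cpow (x : R) : (0 < x)%R ->
      {for x, continuous (fun y : R => (y `^ b / b)%R : R)}.
    move=> x0; apply/differentiable_continuous/derivable1_diffP.
    exact: (@ex_derive _ _ _ _ _ _ _ (dpow x x0)).
  rewrite (@continuous_FTC2 _ _ (fun y : R => (y `^ b / b)%R : R)).
  - by rewrite powR1 div1r EFinB.
  - by rewrite invf_lt1// ltr1n.
  - apply: continuous_in_subspaceT => x; rewrite mem_setE in_itv/= => /andP[ix _].
    have x0 : (0 < x)%R by rewrite (lt_le_trans (i2 i)).
    apply/differentiable_continuous/derivable1_diffP.
    by apply: derivable_powR; rewrite in_itv/= x0.
  - split.
    + move=> x; rewrite in_itv/= => /andP[ix _].
      have x0 : (0 < x)%R by rewrite (lt_trans (i2 i)).
      exact: (@ex_derive _ _ _ _ _ _ _ (dpow x x0)).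
    + by apply: cvg_at_right_filter; exact: cpow.
    + by apply: cvg_at_left_filter; exact: cpow.
  - move=> x; rewrite in_itv/= => /andP[ix _].
    have x0 : (0 < x)%R by rewrite (lt_trans (i2 i)).
    by rewrite derive1E (@derive_val _ _ _ _ _ _ _ (dpow x x0)).
have <- := cvg_lim (@ereal_hausdorff R) cvgF.
apply/cvg_lim => //; under eq_fun do rewrite FE.
apply: cvg_EFin; first by near=> i.
rewrite /= -[X in _ --> X]subr0; apply: cvgB; first exact: cvg_cst.
rewrite -(mul0r (b^-1)%R); apply: cvgMl.
have /cvg_at_rightP := powR_cvg0 b0; apply; split => //.
by have := @cvg_harmonic R; rewrite -cvg_shiftS.
Unshelve. all: by end_near. Qed.

(** The product formula with a = 1, where B(1, b) = 1/b, replaces the integration by parts. *)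
Lemma eGammaD1 b : (0 < b)%R -> eGamma (b + 1) = b%:E * eGamma b.
Proof.
move=> b0; have := eGammaM 1 b.
rewrite (addrC 1%R b) (ebeta1 b0) [eGamma 1]eGamma1 mul1e => E.
by rewrite [X in _ = _ * X]E muleA -EFinM divff ?gt_eqF// mul1e.
Qed.

Lemma eGamma_gt0 a : 0 < eGamma a.
Proof.
(* On [1/2, 1] one has t^(a-1) >= t^m >= 2^(-m) and e^(-t) >= e^(-1), whatever the sign of a - 1. *)
pose m := Num.max 0%R (a - 1)%R.
have m0 : (0 <= m)%R by rewrite /m le_max lexx.
pose c := (2^-1 `^ m * expR (- 1))%R.
have c0 : (0 < c)%R by rewrite mulr_gt0 ?expR_gt0// powR_gt0.
apply: (@lt_le_trans _ _ (\int[mu]_(t in `[2^-1%R, 1%R]) (cst c%:E t))).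
  rewrite integral_cst//= lebesgue_measure_itv/= lte_fin invf_lt1// ltr1n.
  by rewrite -EFinB -EFinM lte_fin mulr_gt0// subr_gt0 invf_lt1// ltr1n.
apply: (@le_trans _ _ (\int[mu]_(t in `[2^-1%R, 1%R]) (power_kernel a t * (expR (- t))%:E))); last first.
  by apply: ge0_subset_integral => //; exact: mgam.
apply: ge0_le_integral => //.
- by move=> t _; rewrite lee_fin ltW.
- by apply: measurable_funTS; exact: mgam.
move=> t /=; rewrite in_itv/= => /andP[t2 t1].
have t0 : (0 < t)%R by rewrite (lt_le_trans _ t2).
rewrite /power_kernel t0 -EFinM lee_fin ler_pM ?powR_ge0 ?expR_ge0//.
  apply: (@le_trans _ R (t `^ m)%R); first by apply: (ge0_ler_powR m0); rewrite // nnegrE ltW.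
  by rewrite ger_powR ?t0 ?t1// /m le_max lexx orbT.
by rewrite ler_expR lerN2.
Qed.

(** Natural arguments follow from the recurrence; an argument x >= 1 from t^(x-1) <= 1 + t^n with n
    + 1 >= x; and 0 < a < 1 from the recurrence read backwards, as an infinite value at a would
    force one at a + 1. *)
Lemma eGamma_lty a : (0 < a)%R -> eGamma a < +oo.
Proof.
have Gn n : eGamma n.+1%:R < +oo.
  elim: n => [|n ih]; first by rewrite eGamma1 ltry.
  by rewrite -natr1 eGammaD1// lte_mul_pinfty// lee_fin.
have G1 x : (1 <= x)%R -> eGamma x < +oo.
  move=> x1; pose n := Num.truncn x.
  have xn : (x <= n.+1%:R)%R by rewrite ltW// truncnS_gt.
  apply: (@le_lt_trans _ _ (eGamma 1 + eGamma n.+1%:R)).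
    rewrite /eGamma -ge0_integralD//; last 2 first.
    - exact: mgam.
    - exact: mgam.
    apply: ge0_le_integral => //.
    - exact: mgam.
    - by apply: emeasurable_funD; exact: mgam.
    move=> t _; rewrite -ge0_muleDl ?power_kernel_ge0//.
    rewrite lee_wpmul2r ?lee_fin ?expR_ge0//.
    rewrite /power_kernel; case: ifPn => t0; last by rewrite addr0.
    have [t1|t1] := leP 1%R t.
      rewrite ler_wpDl ?powR_ge0// ler_powR//.
      by rewrite lerD2r.
    rewrite ler_wpDr ?powR_ge0// subrr powRr0.
    by rewrite -[leRHS](powRr0 t) ger_powR ?t0 ?(ltW t1)// subr_ge0.
  by apply: lte_add_pinfty; [rewrite eGamma1 ltry|exact: Gn].
move=> a0; have : eGamma (a + 1) < +oo by apply: G1; rewrite lerDr ltW.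
rewrite eGammaD1//; have := ltW (eGamma_gt0 a).
case: (eGamma a) => // [r|] _; first by move=> _; exact: ltry.
by rewrite gt0_muley ?lte_fin.
Qed.

Lemma eGammaE a : (0 < a)%R -> eGamma a = (Gamma_fun a)%:E.
Proof.
by move=> a0; rewrite Gamma_funE fineK// ge0_fin_numE ?eGamma_lty// ltW// eGamma_gt0.
Qed.

Lemma Gamma_fun_gt0 a : (0 < a)%R -> (0 < Gamma_fun a)%R.
Proof. by move=> a0; rewrite -lte_fin -eGammaE// eGamma_gt0. Qed.

Lemma Gamma_fun1 : Gamma_fun 1%R = 1%R :> R.
Proof. by rewrite Gamma_funE eGamma1. Qed.

Lemma Gamma_funD1 a : (0 < a)%R -> Gamma_fun (a + 1)%R = (a * Gamma_fun a)%R.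
Proof. by move=> a0; rewrite Gamma_funE eGammaD1// eGammaE. Qed.

Lemma ebetaE a b : (0 < a)%R -> (0 < b)%R ->
  ebeta a b = (Gamma_fun a * Gamma_fun b / Gamma_fun (a + b))%:E.
Proof.
move=> a0 b0; have ab0 : (0 < a + b)%R by rewrite addr_gt0.
have := eGammaM a b; rewrite (eGammaE a0) (eGammaE b0) (eGammaE ab0).
have G0 := Gamma_fun_gt0 ab0.
have := ebeta_ge0 a b; case: (ebeta a b) => // [r|] _; last first.
  by rewrite -EFinM (gt0_mulye (x:=(Gamma_fun (a + b))%:E)).
rewrite -!EFinM => -[->]; congr EFin; apply/esym/mulfK.
by rewrite gt_eqF.
Qed.

End power_kernel.

(** * Continuity on a segment and extension to the line *)

Section clamp.
Variable R : realType.

(** The projection of the line onto [0, T]. Composing with it extends a function continuous on the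
    segment to one continuous everywhere. *)
Definition clamp (T x : R) : R := Num.max 0 (Num.min x T).

Lemma continuous_clamp (T : R) : continuous (clamp T).
Proof.
move=> x; apply: (@continuous_max R _ (cst 0) (fun y : R => Num.min y T)).
  exact: cst_continuous.
by apply: (@continuous_min R _ id (cst T)); [exact: cvg_id|exact: cst_continuous].
Qed.

Lemma clamp_itv (T x : R) : 0 <= T -> 0 <= clamp T x <= T.
Proof. by move=> T0; rewrite /clamp le_max lexx/= ge_max T0 ge_min lexx orbT. Qed.

Lemma clamp_id (T x : R) : 0 <= x <= T -> clamp T x = x.
Proof. by move=> /andP[x0 xT]; rewrite /clamp min_l// max_r. Qed.

Lemma continuous_comp_within (U V W : topologicalType) (A : set V)
    (f : V -> W) (g : U -> V) :
  {within A, continuous f} -> continuous g -> (forall x, A (g x)) ->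
  continuous (f \o g).
Proof.
move=> /subspace_continuousP cf cg Ag x.
apply: (@cvg_comp _ _ _ g f (nbhs x) (within A (nbhs (g x)))); last exact: cf.
move=> P; rewrite /= /within => nP; have nQ := cg x _ nP.
apply: (@filterS _ (nbhs x) _ (fun y => A (g y) -> P (g y))) nQ => // y.
by apply; exact: Ag.
Qed.

Lemma within_continuous_clamp (V : topologicalType) (T : R) (f : R -> V) : 0 <= T ->
  {within `[0, T], continuous f} <-> continuous (f \o clamp T).
Proof.
move=> T0; split=> [cf|cf].
  have := @continuous_comp_within _ _ _ _ f (clamp T) cf (continuous_clamp (T:=T)).
  apply=> x /=.
  by rewrite in_itv/= clamp_itv.
have := continuous_subspaceT (A := `[0, T]%classic) cf.
apply: subspace_eq_continuous => x; rewrite mem_setE in_itv/= => xT.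
by rewrite /from_subspace /= clamp_id.
Qed.

Lemma within_continuous_ext (V : topologicalType) (A : set R) (f g : R -> V) :
  (forall x, A x -> f x = g x) -> {within A, continuous f} -> {within A, continuous g}.
Proof. by move=> fg; apply: subspace_eq_continuous => x /[1!inE]; exact: fg. Qed.

Lemma within_continuousD (A : set R) (f g : R -> R) : {within A, continuous f} ->
  {within A, continuous g} -> {within A, continuous (fun s => f s + g s)}.
Proof. by move=> cf cg x; apply: cvgD; [exact: cf|exact: cg]. Qed.

Lemma within_continuousB (A : set R) (f g : R -> R) : {within A, continuous f} ->
  {within A, continuous g} -> {within A, continuous (fun s => f s - g s)}.
Proof. by move=> cf cg x; apply: cvgB; [exact: cf|exact: cg]. Qed.

Lemma within_continuousM (A : set R) (f g : R -> R) : {within A, continuous f} ->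
  {within A, continuous g} -> {within A, continuous (fun s => f s * g s)}.
Proof. by move=> cf cg x; apply: cvgM; [exact: cf|exact: cg]. Qed.

Lemma within_continuous_cst (A : set R) (k : R) :
  {within A, continuous (fun _ : R => k : R)}.
Proof. by move=> x; exact: cvg_cst. Qed.

Lemma within_continuous_id (A : set R) : {within A, continuous (fun x : R => x)}.
Proof. by apply: continuous_subspaceT => x; exact: cvg_id. Qed.

Lemma within_continuous_bounded (T : R) (f : R -> R) :
  {within `[0, T], continuous f} ->
  exists2 C : R, 0 <= C & forall x : R, 0 <= x <= T -> `|f x| <= C.
Proof.
move=> cf.
have /compact_bounded[M [_ mrt]] := continuous_compact cf (@segment_compact R 0 T).
exists (Num.max 0 (M + 1)); first by rewrite le_max lexx.
move=> x xT; rewrite le_max; apply/orP; right.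
by apply: mrt; [rewrite ltrDl|exists x => //=; rewrite in_itv].
Qed.

Lemma continuous_pospowR (a : R) : 0 < a -> continuous (fun x : R => (Num.max 0 x) `^ a).
Proof.
move=> a0 x; have [x0|x0|->] := ltgtP (x : R) 0.
- apply: (@cvg_trans _ ((cst 0 : R -> R) @ x)).
    apply: near_eq_cvg; near=> y; rewrite max_l ?powR0 ?gt_eqF//.
    by apply: ltW; near: y; exact: lt_nbhsl.
  by rewrite max_l ?ltW// powR0 ?gt_eqF//; exact: (@cst_continuous _ _ (0 : R) x).
- apply: (@cvg_trans _ (y `^ a @[y --> x])).
    apply: near_eq_cvg; near=> y; rewrite max_r//.
    by apply: ltW; near: y; exact: lt_nbhsr.
  rewrite max_r ?ltW//.
  have cx : {for x, continuous (fun y : R => y `^ a)}.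
    apply/differentiable_continuous/derivable1_diffP.
    by apply: derivable_powR; rewrite in_itv/= x0.
  exact: cx.
- apply/left_right_continuousP; rewrite maxxx powR0 ?gt_eqF//; split.
    apply: (@cvg_trans _ ((cst 0 : R -> R) @ 0^'-)); last first.
      by apply: cvg_at_left_filter; exact: (@cst_continuous _ _ (0 : R) 0).
    apply: near_eq_cvg; near=> y; rewrite max_l ?powR0 ?gt_eqF//.
  apply: (@cvg_trans _ (y `^ a @[y --> 0^'+])); last exact: powR_cvg0.
  by apply: near_eq_cvg; near=> y; rewrite max_r.
Unshelve. all: by end_near. Qed.

Lemma within_continuous_powR (a T : R) : 0 < a ->
  {within `[0, T], continuous (fun x : R => x `^ a)}.
Proof.
move=> a0; apply: (@within_continuous_ext _ _ (fun x => (Num.max 0 x) `^ a)).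
  by move=> x /=; rewrite in_itv/= => /andP[x0 _]; rewrite max_r.
by apply: continuous_subspaceT; exact: continuous_pospowR.
Qed.

End clamp.

(** * Fractional integrals: integrability, linearity and bounds *)

Section frac_int.
Variable R : realType.
Notation mu := (@lebesgue_measure R).
Implicit Types (a b t C T : R) (h : R -> R).

(** The Riemann-Liouville integral without its factor 1/Gamma(a); Gamma factors therefore appear in
    the semigroup law below. *)
Definition frac_int a h t : R :=
  \int[mu]_(s in `[0, t]) ((t - s) `^ (a - 1) * h s).

(** Extension by 0 of the restriction of [h] to positive arguments, not the positive part of its
    values. Convolving it with a truncated power only involves [h] on ]0, t[. *)
Definition pos_part_of h : R -> \bar R := fun s => (if 0 < s then h s else 0)%:E.

Let mker a t : measurable_fun [set: R] (fun s : R => (t - s) `^ (a - 1)).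
Proof.
by apply: (measurableT_comp (measurable_powR (a - 1))); apply: measurable_funB.
Qed.

Lemma within_continuous_measurable T h :
  {within `[0, T], continuous h} -> measurable_fun `[0, T] h.
Proof. by move=> ch; apply: subspace_continuous_measurable_fun. Qed.

Lemma integral_frac_intE a h t : measurable_fun `[0, t] h ->
  (\int[mu]_(s in `[0%R, t]) ((t - s) `^ (a - 1) * h s)%:E)%E =
  convolution (power_kernel a) (pos_part_of h) t.
Proof.
move=> mh.
have mi : measurable_fun `[0, t] (fun s => ((t - s) `^ (a - 1) * h s)%:E).
  apply/measurable_EFinP; apply: measurable_funM => //.
  by apply: measurable_funTS; exact: mker.
rewrite -integral_itv_obnd_cbnd; last first.
  by apply: measurable_funS mi => //; exact: subset_itv_oc_cc.
rewrite -integral_itv_bndo_bndc; last first.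
  by apply: measurable_funS mi => //; exact: subset_itv_oo_cc.
rewrite integral_mkcond; apply: eq_integral => s _.
rewrite patchE mem_setE in_itv/= /power_kernel /pos_part_of subr_gt0.
by case: ifPn => [/andP[-> ->]//|]; rewrite negb_and => /orP[]/negPf ->;
  rewrite -EFinM ?mulr0 ?mul0r.
Qed.

Lemma pos_part_of_powR b : pos_part_of (fun s => s `^ (b - 1)) = power_kernel b.
Proof. by []. Qed.

Lemma pos_part_of1 : pos_part_of (cst 1) = power_kernel 1.
Proof. by apply/funext => s; rewrite /pos_part_of /power_kernel subrr powRr0. Qed.

Lemma frac_int0 a h : frac_int a h 0 = 0.
Proof. by rewrite /frac_int set_itv1 Rintegral_set1. Qed.

Lemma frac_int_powR a b t : 0 < a -> 0 < b -> 0 < t ->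
  frac_int a (fun s => s `^ (b - 1)) t =
  Gamma_fun a * Gamma_fun b / Gamma_fun (a + b) * t `^ (a + b - 1).
Proof.
move=> a0 b0 t0; rewrite /frac_int /Rintegral integral_frac_intE; last first.
  by apply: measurable_funTS; exact: measurable_powR.
by rewrite pos_part_of_powR convolution_power_kernel ebetaE// /power_kernel t0.
Qed.

Lemma integrable_powR_sub a t : 0 < a ->
  mu.-integrable `[0, t] (fun s => ((t - s) `^ (a - 1))%:E).
Proof.
move=> a0; apply/integrableP; split.
  by apply: measurable_funTS; apply/measurable_EFinP; exact: mker.
under eq_integral do rewrite gee0_abs ?lee_fin ?powR_ge0//.
under eq_integral do rewrite -[X in X%:E]mulr1.
rewrite (@integral_frac_intE _ (cst 1)); last exact: measurable_cst.
by rewrite pos_part_of1 convolution_power_kernel ebetaE// /power_kernel -EFinM ltry.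
Qed.

Lemma integrable_frac_int a h t : 0 < a -> {within `[0, t], continuous h} ->
  mu.-integrable `[0, t] (fun s => ((t - s) `^ (a - 1) * h s)%:E).
Proof.
move=> a0 ch.
have [C C0 hC] := within_continuous_bounded ch.
have := @integrableMr _ _ _ mu _ (measurable_itv `[0, t]) h _
  (within_continuous_measurable ch) _ (integrable_powR_sub t a0).
have hb : [bounded h x | x in `[0, t]%classic].
  exists C; split; rewrite ?num_real// => M CM x /=; rewrite in_itv/= => xt.
  by rewrite (le_trans (hC _ xt))// ltW.
move=> /(_ hb); apply: eq_integrable => //.
by move=> s _ /=; rewrite EFinM muleC.
Qed.

Lemma EFin_frac_int a h t : 0 < a -> {within `[0, t], continuous h} ->
  (frac_int a h t)%:E = convolution (power_kernel a) (pos_part_of h) t.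
Proof.
move=> a0 ch; rewrite -integral_frac_intE; last exact: within_continuous_measurable.
rewrite /frac_int /Rintegral fineK//.
by apply: integrable_fin_num => //; exact: integrable_frac_int.
Qed.

Lemma frac_int1 a t : 0 < a -> 0 <= t -> frac_int a (cst 1) t = t `^ a / a.
Proof.
move=> a0; rewrite le_eqVlt => /predU1P[<-|t0].
  by rewrite frac_int0 powR0 ?gt_eqF// mul0r.
have -> : cst 1 = (fun s : R => s `^ (1 - 1)).
  by apply/funext => s; rewrite subrr powRr0.
rewrite frac_int_powR// Gamma_fun1 mulr1 Gamma_funD1// addrK.
by have := Gamma_fun_gt0 a0 => G0; field; rewrite !gt_eqF.
Qed.

Lemma eq_frac_int a h1 h2 t : (forall s, 0 <= s <= t -> h1 s = h2 s) ->
  frac_int a h1 t = frac_int a h2 t.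
Proof.
move=> h12; apply: eq_Rintegral => s; rewrite mem_setE in_itv/= => st.
by rewrite h12.
Qed.

Lemma frac_intD a h1 h2 t : 0 < a ->
  {within `[0, t], continuous h1} -> {within `[0, t], continuous h2} ->
  frac_int a (fun s => h1 s + h2 s) t = frac_int a h1 t + frac_int a h2 t.
Proof.
move=> a0 c1 c2; rewrite /frac_int -RintegralD//; last 2 first.
- exact: integrable_frac_int.
- exact: integrable_frac_int.
by apply: eq_Rintegral => s _; rewrite mulrDr.
Qed.

Lemma frac_intZ a k h t : 0 < a -> {within `[0, t], continuous h} ->
  frac_int a (fun s => k * h s) t = k * frac_int a h t.
Proof.
move=> a0 ch; rewrite /frac_int -RintegralZl//; last exact: integrable_frac_int.
by apply: eq_Rintegral => s _; rewrite mulrCA.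
Qed.

Lemma frac_intB a h1 h2 t : 0 < a ->
  {within `[0, t], continuous h1} -> {within `[0, t], continuous h2} ->
  frac_int a (fun s => h1 s - h2 s) t = frac_int a h1 t - frac_int a h2 t.
Proof.
move=> a0 c1 c2; rewrite /frac_int -RintegralB//; last 2 first.
- exact: integrable_frac_int.
- exact: integrable_frac_int.
by apply: eq_Rintegral => s _; rewrite mulrBr.
Qed.

Lemma frac_int_bound a C h t : 0 < a -> 0 <= t -> {within `[0, t], continuous h} ->
  (forall s, 0 <= s <= t -> `|h s| <= C) -> `|frac_int a h t| <= t `^ a / a * C.
Proof.
move=> a0 t0 ch hC; rewrite -frac_int1// /frac_int.
apply: le_trans (le_normr_Rintegral _ (integrable_frac_int a0 ch)) _ => //.
have ik := integrable_powR_sub t a0.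
under [X in _ <= X * _]eq_Rintegral do rewrite mulr1.
rewrite -RintegralZr//; apply: le_Rintegral => //.
- by apply: integrable_norm (integrable_frac_int a0 ch).
- have : mu.-integrable `[0, t] (fun s => C%:E * ((t - s) `^ (a - 1))%:E)%E.
    exact: integrableZl.
  apply: eq_integrable => //.
  by move=> s _ /=; rewrite -EFinM mulrC.
move=> s /=; rewrite in_itv/= => st.
rewrite normrM ger0_norm ?powR_ge0// ler_wpM2l ?powR_ge0//; exact: hC.
Qed.

End frac_int.

(** * Continuity and semigroup law of fractional integrals *)

Section frac_int_theory.
Variable R : realType.
Notation mu := (@lebesgue_measure R).
Implicit Types (a b t C T : R) (h : R -> R).

Lemma subset_within_continuous h t T : t <= T ->
  {within `[0, T], continuous h} -> {within `[0, t], continuous h}.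
Proof.
by move=> tT; apply: continuous_subspaceW => x /=; rewrite !in_itv/= => /andP[-> /le_trans->].
Qed.

(** The substitution s = t x. The sign condition is that of the change of variables in [0, +oo];
    signed functions are later shifted by a constant. *)
Lemma frac_int_scale a h t : 0 < a -> 0 <= t -> continuous h ->
  (forall s, 0 <= h s) ->
  frac_int a h t = t `^ a * frac_int a (fun x => h (t * x)) 1.
Proof.
move=> a0 + ch h0; rewrite le_eqVlt => /predU1P[<-|t0].
  by rewrite frac_int0 powR0 ?gt_eqF// mul0r.
have cht : continuous (fun x => h (t * x)).
  by move=> x; apply: (@continuous_comp _ _ _ ( *%R t) h); [exact: mulrl_continuous|exact: ch].
apply: EFin_inj; rewrite EFinM !EFin_frac_int//; try exact: continuous_subspaceT.
have mp g : continuous g -> measurable_fun [set: R] (pos_part_of g).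
  move=> cg; apply/measurable_EFinP; apply: measurable_fun_ifT => //.
    exact: measurable_fun_ltr.
  exact: continuous_measurable_fun.
have p0 x : (0 <= pos_part_of h x)%E by rewrite lee_fin; case: ifP.
have pE x : pos_part_of h (t * x) = pos_part_of (fun x => h (t * x)) x.
  by rewrite /pos_part_of pmulr_rgt0.
rewrite /convolution (@ge0_integral_affine _ t 0)//; last 2 first.
- apply: emeasurable_funM; last exact: mp.
  by apply: (measurableT_comp (measurable_power_kernel a)); apply: measurable_funB.
- by move=> x; rewrite mule_ge0// power_kernel_ge0.
under eq_integral => x _.
  rewrite addr0 (_ : t - t * x = t * (1 - x)); last by rewrite mulrBr mulr1.
  rewrite power_kernelM// pE -muleA.
  over.
rewrite ge0_integralZl//=; last 3 first.
- apply: emeasurable_funM; last exact: mp.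
  by apply: (measurableT_comp (measurable_power_kernel a)); apply: measurable_funB.
- by move=> x _; rewrite mule_ge0 ?power_kernel_ge0// -pE.
- by rewrite lee_fin powR_ge0.
by rewrite muleA -EFinM mulr_powRB1// ltW.
Qed.

Lemma continuous_frac_int a h T : 0 < a -> 0 <= T ->
  {within `[0, T], continuous h} -> {within `[0, T], continuous (frac_int a h)}.
Proof.
move=> a0 T0 ch.
(* After rescaling to [0, 1] the singularity of the kernel no longer depends on
   the parameter and dominated convergence applies. *)
have [C C0 hC] := within_continuous_bounded ch.
(* [g] is nonnegative and continuous on the whole line; the contribution of the added constant, C
   x^a / a, is subtracted again. *)
pose g x := h (clamp T x) + C.
have cg : continuous g.
  move=> x; apply: cvgD; last exact: cvg_cst.
  exact: (proj1 (within_continuous_clamp h T0) ch).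
have gb x : 0 <= g x <= C + C.
  have := hC _ (clamp_itv x T0); rewrite ler_norml /g lerD2r => /andP[h1 ->].
  by rewrite andbT -lerBlDr sub0r.
have Eg x : 0 <= x <= T -> frac_int a h x = x `^ a * frac_int a (fun y => g (x * y)) 1 - C * (x `^ a / a).
  move=> /andP[x0 xT].
  rewrite -frac_int_scale//; last by move=> s; case/andP: (gb s).
  rewrite -(frac_int1 a0 x0) -frac_intZ//; last first.
    by apply: continuous_subspaceT; exact: cst_continuous.
  rewrite -frac_intB//; last 2 first.
  - exact: continuous_subspaceT.
  - by apply: continuous_subspaceT => y; exact: (@cst_continuous _ _ (C * 1) y).
  apply: eq_frac_int => s /andP[s0 sx].
  by rewrite /g clamp_id ?mulr1 ?addrK// s0 (le_trans sx).
apply: (@within_continuous_ext _ _ _ (fun x => x `^ a * frac_int a (fun y => g (x * y)) 1 - C * (x `^ a / a))).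
  by move=> x /=; rewrite in_itv/= => xT; rewrite Eg.
have cp := within_continuous_powR (a := a) (T := T) a0.
have cgy (y : R) (x : R) : {for x, continuous (fun z : R => g (z * y))}.
  by apply: (@continuous_comp _ _ _ (fun z : R => z * y) g); [exact: mulrr_continuous|exact: cg].
pose Phi x := frac_int a (fun y => g (x * y)) 1.
(* Continuity under the integral sign is available on an open interval of parameters, hence the
   enlargement of [0, T]; [g] is defined and bounded there as well. *)
have cPhi : {in `]-1, T + 1[%classic, continuous Phi}.
  apply: (@continuity_under_integral R _ _ mu (fun x y => (1 - y) `^ (a - 1) * g (x * y)) `[0, 1]%classic
    (measurable_itv _) (-1) (T + 1) _ _ (fun y => (C + C) * (1 - y) `^ (a - 1))).
  - move=> x _; apply: (integrable_frac_int a0); apply: continuous_subspaceT => y.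
    by apply: (@continuous_comp _ _ _ ( *%R x) g); [exact: mulrl_continuous|exact: cg].
  - apply: aeW => y _ x _; apply: cvgM; first exact: cvg_cst.
    exact: (cgy y x).
  - have : mu.-integrable `[0, 1] (fun s => (C + C)%:E * ((1 - s) `^ (a - 1))%:E)%E.
      by apply: integrableZl => //; exact: integrable_powR_sub.
    by apply: eq_integrable => // s _ /=; rewrite -EFinM.
  - move=> x _; apply: aeW => y _; have /andP[g0 gC] := gb (x * y).
    by rewrite ger0_norm ?mulr_ge0 ?powR_ge0// mulrC ler_wpM2r ?powR_ge0.
apply/subspace_continuousP => x xT.
have cpx := proj1 (subspace_continuousP _ _) cp x xT.
apply: cvgB; last by apply: cvgM; [exact: cvg_cst|apply: cvgMl; exact: cpx].
apply: cvgM; first exact: cpx.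
apply: cvg_within_filter; apply: cPhi.
move: xT => /=; rewrite inE/= !in_itv/= => /andP[x0 xT].
by rewrite (lt_le_trans _ x0) ?ltrN10//= (le_lt_trans xT)// ltrDl.
Qed.

(** Associativity of convolution reduces the law to t_+^(a-1) convolved with t_+^(b-1), which is
    B(a, b) t_+^(a+b-1). *)
Lemma frac_int_ge0_semigroup a b h t : 0 < a -> 0 < b -> 0 <= t -> continuous h ->
  (forall s, 0 <= h s) ->
  frac_int a (frac_int b h) t =
  Gamma_fun a * Gamma_fun b / Gamma_fun (a + b) * frac_int (a + b) h t.
Proof.
move=> a0 b0 t0 ch h0; have ab0 : 0 < a + b by rewrite addr_gt0.
have cw x : {within `[0, x], continuous h} by exact: continuous_subspaceT.
have cJ : {within `[0, t], continuous (frac_int b h)} by exact: continuous_frac_int.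
have mk c : measurable_fun [set: R] (power_kernel c) by exact: measurable_power_kernel.
have k0 c x : (0 <= power_kernel c x)%E by exact: power_kernel_ge0.
have mp : measurable_fun [set: R] (pos_part_of h).
  apply/measurable_EFinP; apply: measurable_fun_ifT => //.
    exact: measurable_fun_ltr.
  exact: continuous_measurable_fun.
have p0 x : (0 <= pos_part_of h x)%E by rewrite lee_fin; case: ifP.
(* For s <= 0 the segment [0, s] is empty or a point, so that the inner convolution vanishes there,
   in agreement with the truncation. *)
have pJ : pos_part_of (frac_int b h) = convolution (power_kernel b) (pos_part_of h).
  apply/funext => s; rewrite -(EFin_frac_int b0 (cw s)) /pos_part_of.
  case: ltP => // s0; congr EFin; rewrite /frac_int; move: s0.
  rewrite le_eqVlt => /predU1P[->|s0]; first by rewrite set_itv1 Rintegral_set1.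
  by rewrite set_itv_ge ?Rintegral_set0// bnd_simp -ltNge.
apply: EFin_inj; rewrite EFinM !EFin_frac_int// pJ convolutionA//.
have mi : measurable_fun [set: R]
    (fun s : R => power_kernel (a + b) (t - s) * pos_part_of h s)%E.
  apply: emeasurable_funM => //.
  by apply: (measurableT_comp (mk _)); apply: measurable_funB.
have cZ : (\int[mu]_s (ebeta a b * (power_kernel (a + b) (t - s)%R * pos_part_of h s)) =
    ebeta a b * convolution (power_kernel (a + b)) (pos_part_of h) t)%E.
  rewrite /convolution; apply: (@ge0_integralZl _ _ _ mu setT measurableT _ mi); last exact: ebeta_ge0.
  by move=> s _; rewrite mule_ge0.
rewrite -(ebetaE a0 b0) -[RHS]cZ.
apply: eq_integral => s _.
by rewrite convolution_power_kernel muleA.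
Qed.

(** Both sides are linear in [h], which on [0, t] is the difference of the nonnegative continuous
    functions h + C and C. *)
Lemma frac_int_semigroup a b h t : 0 < a -> 0 < b -> 0 <= t ->
  {within `[0, t], continuous h} ->
  frac_int a (frac_int b h) t =
  Gamma_fun a * Gamma_fun b / Gamma_fun (a + b) * frac_int (a + b) h t.
Proof.
move=> a0 b0 t0 ch; have ab0 : 0 < a + b by rewrite addr_gt0.
have [C C0 hC] := within_continuous_bounded ch.
pose c : R -> R := cst C; pose g x := h (clamp t x) + C.
have cc : continuous c by exact: cst_continuous.
have cg : continuous g.
  move=> x; apply: cvgD; last exact: cvg_cst.
  exact: (proj1 (within_continuous_clamp h t0) ch).
have g0 x : 0 <= g x.
  by have := hC _ (clamp_itv x t0); rewrite ler_norml -subr_ge0 opprK => /andP[].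
have wc u : {within `[0, u], continuous c} by exact: continuous_subspaceT.
have wg u : {within `[0, u], continuous g} by exact: continuous_subspaceT.
have hE s : 0 <= s <= t -> h s = g s - c s.
  by move=> st; rewrite /g clamp_id// addrK.
have JE d : 0 < d -> forall s, 0 <= s <= t -> frac_int d h s = frac_int d g s - frac_int d c s.
  move=> d0 s /andP[s0 st]; rewrite -frac_intB//; apply: eq_frac_int => u /andP[u0 us].
  by rewrite hE// u0 (le_trans us).
rewrite (@eq_frac_int _ a _ (fun s => frac_int b g s - frac_int b c s)); last exact: JE.
rewrite frac_intB//; try exact: continuous_frac_int.
by rewrite !frac_int_ge0_semigroup// -mulrBr -JE// t0 lexx.
Qed.

Lemma frac_intE a h t :
  frac_int a h t = \int[mu]_(s in `[0, t]) ((t - s) `^ (a - 1) * h s).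
Proof. by []. Qed.

Lemma frac_int_1E h t : frac_int 1 h t = \int[mu]_(s in `[0, t]) h s.
Proof. by apply: eq_Rintegral => s _; rewrite subrr powRr0 mul1r. Qed.

End frac_int_theory.

#[local] Opaque Gamma_fun frac_int.

(** * One-sided derivatives and the Caputo derivative *)

Section caputo.
Variable R : realType.
Notation mu := (@lebesgue_measure R).
Implicit Types (T t l : R) (x y F h : R -> R).

Lemma near_within_dnbhs T t (P : R -> Prop) :
  (forall s, 0 <= s <= T -> s != t -> P s) ->
  \forall s \near within `[0, T]%classic t^', P s.
Proof.
move=> HP; rewrite near_withinE; apply/nbhs_ballP; exists 1 => //= s _ st.
by rewrite in_itv/= => sT; apply: HP.
Qed.

Lemma has_deriv_ext T t l x y : 0 <= t <= T -> (forall s, 0 <= s <= T -> x s = y s) ->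
  has_deriv T x t l -> has_deriv T y t l.
Proof.
move=> tT xy; apply: cvg_trans; apply: near_eq_cvg.
by apply: near_within_dnbhs => s sT _; rewrite !xy.
Qed.

Lemma deriv_on_ext T x y x' y' : (forall s, 0 <= s <= T -> x s = y s) ->
  (forall s, 0 <= s <= T -> x' s = y' s) -> deriv_on T x x' -> deriv_on T y y'.
Proof. by move=> xy xy' dx t tT; rewrite -xy'//; exact: has_deriv_ext (dx t tT). Qed.

Lemma has_deriv_affine T t l x A b k : has_deriv T x t l ->
  has_deriv T (fun s => A + b * s + k * x s) t (b + k * l).
Proof.
move=> dx; apply: (@cvg_trans _ ((b + k * ((x s - x t) / (s - t))) @[s --> within `[0, T]%classic t^'])).
  apply: near_eq_cvg; apply: near_within_dnbhs => s _ st.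
  by field; rewrite subr_eq0.
by apply: cvgD; [exact: cvg_cst|apply: cvgMr; exact: dx].
Qed.

(** Two different limits would make the punctured filter within [0, T] trivial. It is not: as 0 < T,
    each punctured neighbourhood of t meets [0, T], on the right of t if t < T and on the left if t
    = T. *)
Lemma has_deriv_unique T t l1 l2 x : 0 < T -> 0 <= t <= T ->
  has_deriv T x t l1 -> has_deriv T x t l2 -> l1 = l2.
Proof.
move=> T0 /andP[t0 tT] /cvgrPdist_lt d1 /cvgrPdist_lt d2.
apply: contrapT => /eqP l12.
pose e := `|l1 - l2| / 2.
have e0 : 0 < e by rewrite divr_gt0// normr_gt0 subr_eq0.
have : \forall s \near within `[0, T]%classic t^', False.
  near=> s.
  have h1 : `|l1 - (x s - x t) / (s - t)| < e by near: s; exact: d1.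
  have h2 : `|l2 - (x s - x t) / (s - t)| < e by near: s; exact: d2.
  have : `|l1 - l2| < e + e.
    rewrite (le_lt_trans _ (ltrD h1 h2))// [X in _ <= _ + X]distrC.
    exact: ler_distD.
  by rewrite -splitr ltxx.
rewrite near_withinE => /nbhs_ballP[r /= r0 Hr].
have [tT'|Tt] := ltP t T.
  pose d := Num.min (r / 2) (T - t).
  have d0 : 0 < d by rewrite lt_min divr_gt0// subr_gt0.
  have dr : d < r by rewrite gt_min ltr_pdivrMr// ltr_pMr// ltr1n.
  have dT : d <= T - t by rewrite ge_min lexx orbT.
  apply: (Hr (t + d)).
  - by rewrite /ball/= opprD addrA subrr sub0r normrN gtr0_norm.
  - by rewrite gt_eqF// ltrDl.
  - by rewrite in_itv/= (addr_ge0 t0 (ltW d0))/= -lerBrDl.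
pose d := Num.min (r / 2) t.
have d0 : 0 < d by rewrite lt_min divr_gt0//= (lt_le_trans T0).
have dr : d < r by rewrite gt_min ltr_pdivrMr// ltr_pMr// ltr1n.
have dt : d <= t by rewrite ge_min lexx orbT.
apply: (Hr (t - d)).
- by rewrite /ball/= subKr gtr0_norm.
- by rewrite lt_eqF// ltrBlDr ltrDl.
- by rewrite in_itv/= subr_ge0 dt/= (le_trans _ tT)// gerBl ltW.
Unshelve. all: by end_near. Qed.

Lemma derivable_has_deriv T t F : derivable F t 1 -> has_deriv T F t ('D_1 F t).
Proof.
move=> dF; apply: cvg_within_filter.
have tt0 : (s - t) @[s --> t^'] --> 0^'.
  move=> P /nbhs_ballP[e /= e0 He]; apply/nbhs_ballP; exists e => //= s ts st.
  by apply: He; rewrite ?subr_eq0// /ball/= sub0r normrN distrC.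
apply: (@cvg_trans _ ((fun h : R => h^-1 *: ((F \o shift t) (h *: (1 : R)) - F t)) (s - t) @[s --> t^'])).
  apply: near_eq_cvg; apply: nearW => s /=.
  by rewrite /GRing.scale/= mulr1 subrK mulrC.
exact: (@cvg_comp _ _ _ (fun s => s - t)
  (fun h : R => h^-1 *: ((F \o shift t) (h *: (1 : R)) - F t)) t^' 0^' _ tt0 dF).
Qed.

Lemma deriv_on_frac_int1 T h : 0 <= T -> {within `[0, T], continuous h} ->
  deriv_on T (frac_int 1 h) h.
Proof.
move=> T0 ch t tT; have /andP[t0 _] := tT.
pose g := h \o clamp T; have cg : continuous g by exact/within_continuous_clamp.
have gi a b : mu.-integrable `[a, b] (EFin \o g).
  apply: continuous_compact_integrable; first exact: segment_compact.
  exact: continuous_subspaceT.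
(* Integrating from -1, with t + 1 as upper limit of the domain, makes every t in [0, T] an interior
   point. The two-sided derivative then restricts to the one-sided ones at 0 and T. *)
pose F (z : R) := \int[mu]_(s in `[-1, z]) g s.
have FE s : 0 <= s <= T -> F s - F 0 = frac_int 1 h s.
  move=> /andP[s0 sT]; rewrite frac_int_1E /F Rintegral_itvB//; last by rewrite bnd_simp lerN10.
  rewrite Rintegral_itv_obnd_cbnd; last first.
    apply: integrableS (gi 0 s) => //; exact: subset_itv_oc_cc.
  apply: eq_Rintegral => u; rewrite mem_setE in_itv/= => /andP[u0 us].
  by rewrite /g/= clamp_id// u0 (le_trans us).
have [dF F'] : derivable F t 1 /\ F^`()%classic t = g t.
  apply: (@continuous_FTC1_closed R g (-1) t (t + 1)) => //.
  - by rewrite ltrDl.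
  - by rewrite (lt_le_trans _ t0)// ltrN10.
  - exact: cg.
have := derivable_has_deriv T dF; rewrite -derive1E F' /g/= clamp_id//.
apply: cvg_trans; apply: near_eq_cvg; apply: near_within_dnbhs => s sT _.
by rewrite -!FE// opprB addrA subrK.
Qed.

Lemma has_caputo_ext p T x y y' : (forall s, 0 <= s <= T -> y s = y' s) ->
  has_caputo p T x y -> has_caputo p T x y'.
Proof.
move=> yy' [x' [dx cx' H]]; exists x'; split => //; move: H; case: ifP => _.
  by move=> [z dz1 dz2]; exists z => //; exact: deriv_on_ext dz2.
exact: deriv_on_ext.
Qed.

(** [caputo_primitive] depends on the value at 0 of the chosen derivative of [x], so these
    derivatives are identified before the primitives are compared. *)
Lemma has_caputo_unique p T x y1 y2 : 0 < T -> has_caputo p T x y1 ->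
  has_caputo p T x y2 -> forall t, 0 <= t <= T -> y1 t = y2 t.
Proof.
move=> T0 [x1 [d1 _ H1]] [x2 [d2 _ H2]].
have U F a b : deriv_on T F a -> deriv_on T F b -> forall t, 0 <= t <= T -> a t = b t.
  by move=> da db t tT; exact: (has_deriv_unique T0 tT (da t tT) (db t tT)).
have x12 : forall t, 0 <= t <= T -> x1 t = x2 t by exact: U d1 d2.
move: H1 H2; case: ifP => _.
  move=> [z1 dz1 dy1] [z2 dz2 dy2].
  have x120 : x1 0 = x2 0 by rewrite x12// lexx ltW.
  rewrite x120 in dz1.
  have z12 := U _ _ _ dz1 dz2.
  apply: U dy1 _; apply: deriv_on_ext dy2 => // s sT; by rewrite z12.
move=> H1 H2; apply: U H1 _; apply: deriv_on_ext H2 => // s sT; by rewrite x12.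
Qed.

(** With I^a the normalised integral, x' = b + I^(p-1) h, so that x(0) = A and x'(0) = b. For p < 2
    the primitive is I^(2-p) I^p h = I^2 h = I^1 I^1 h, which the fundamental theorem differentiates
    twice; for p = 2, x' is already b + I^1 h. *)
Lemma has_caputo_frac_int p T A b x h : 0 < T -> 1 < p <= 2 ->
  {within `[0, T], continuous h} ->
  (forall t, 0 <= t <= T -> x t = A + b * t + (Gamma_fun p)^-1 * frac_int p h t) ->
  has_caputo p T x h.
Proof.
move=> T0 /andP[p1 p2] ch xE.
have T0' := ltW T0.
have p0 : 0 < p by rewrite (lt_trans _ p1).
have q0 : 0 < p - 1 by rewrite subr_gt0.
have Gp := Gamma_fun_gt0 p0; have Gq := Gamma_fun_gt0 q0.
have chs t : t <= T -> {within `[0, t], continuous h}.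
  by move=> tT; exact: subset_within_continuous ch.
pose x' t := b + (Gamma_fun (p - 1))^-1 * frac_int (p - 1) h t.
have cq : {within `[0, T], continuous (frac_int (p - 1) h)} by exact: continuous_frac_int.
have GpE : Gamma_fun p = (p - 1) * Gamma_fun (p - 1) :> R by rewrite -(Gamma_funD1 q0) subrK.
have G2 : Gamma_fun 2 = 1 :> R.
  by rewrite (_ : 2 = 1 + 1 :> R); [rewrite (Gamma_funD1 ltr01) Gamma_fun1 mulr1|].
have dxx' : deriv_on T x x'.
  apply: (@deriv_on_ext T (fun t => A + b * t + (Gamma_fun (p - 1))^-1 * frac_int 1 (frac_int (p - 1) h) t) x x'); [|by []|].
    move=> t /[dup] tT /andP[t0 tT'].
    rewrite (xE _ tT) (frac_int_semigroup ltr01 q0 t0 (chs _ tT')).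
    rewrite (addrC 1) subrK Gamma_fun1 mul1r GpE; congr (_ + _).
    by field; rewrite ?(gt_eqF Gq) ?(gt_eqF q0).
  move=> t tT; apply: has_deriv_affine; exact: deriv_on_frac_int1.
have cx' : {within `[0, T], continuous x'}.
  apply/subspace_continuousP => t tT.
  apply: cvgD; first exact: cvg_cst.
  by apply: cvgMr; exact: (proj1 (subspace_continuousP _ _) cq t tT).
exists x'; split => //; case: ltP => [p2'|pge2].
  have r0 : 0 < 2 - p by rewrite subr_gt0.
  have Gr := Gamma_fun_gt0 r0.
  have cJ1 : {within `[0, T], continuous (frac_int 1 h)} by exact: continuous_frac_int.
  exists (frac_int 1 h); last exact: deriv_on_frac_int1.
  apply: (@deriv_on_ext T (frac_int 1 (frac_int 1 h)) _ (frac_int 1 h)); [|by []|exact: deriv_on_frac_int1].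
  move=> t /andP[t0 tT]; have ct := chs t tT.
  rewrite (frac_int_semigroup ltr01 ltr01 t0 ct) Gamma_fun1 mulr1 G2 divr1 mul1r.
  rewrite /caputo_primitive.
  have -> : \int[mu]_(s in `[0, t]) ((t - s) `^ (1 - p) * (x s - x 0 - x' 0 * s)) =
      frac_int (2 - p) (fun s => (Gamma_fun p)^-1 * frac_int p h s) t.
    rewrite frac_intE; apply: eq_Rintegral => s; rewrite mem_setE in_itv/= => /andP[s0 st].
    have sT : 0 <= s <= T by rewrite s0 (le_trans st).
    rewrite (_ : 2 - p - 1 = 1 - p); last by ring.
    rewrite (xE _ sT) (xE 0) ?lexx// /x' !frac_int0; congr (_ * _); ring.
  rewrite (frac_intZ _ r0 (continuous_frac_int p0 t0 ct)).
  rewrite (frac_int_semigroup r0 p0 t0 ct) subrK G2 divr1.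
  by field; rewrite ?(gt_eqF Gr) ?(gt_eqF Gp).
have pE : p = 2 by apply/eqP; rewrite eq_le p2.
have -> : x' = fun t => b + 0 * t + 1 * frac_int 1 h t.
  apply/funext => t; rewrite /x' pE (_ : 2 - 1 = 1 :> R); last by ring.
  by rewrite Gamma_fun1 invr1 mul0r addr0.
move=> t tT; rewrite -[h t]mul1r -[1 * h t]add0r; apply: has_deriv_affine.
exact: deriv_on_frac_int1.
Qed.

End caputo.

(** * Concavity of powers with exponent at most 1 *)

Section powR_concave.
Variable R : realType.
Implicit Types (x y u l th : R).

(** The right-hand side is the tangent of u^th at 1. It comes from Young's inequality for u^th and
    1, with exponents 1/th and 1/(1 - th). *)
Lemma powR_le_tangent u th : 0 <= u -> 0 < th <= 1 -> u `^ th <= th * u + (1 - th).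
Proof.
move=> u0 /andP[th0]; rewrite le_eqVlt => /predU1P[->|th1].
  by rewrite powRr1// mul1r subrr addr0.
have th1' : 0 < 1 - th by rewrite subr_gt0.
have := @conjugate_powR R (u `^ th) 1 th^-1 (1 - th)^-1.
rewrite powR_ge0 ler01 !invr_gt0 th0 th1' !invrK addrC subrK => /(_ isT isT isT isT erefl).
by rewrite mulr1 powR1 mul1r -powRrM mulfV ?gt_eqF// powRr1// [u * th]mulrC.
Qed.

(** After division by the mean m, the tangent inequality at x/m and y/m averages to 1. If m = 0,
    both terms on the left vanish. *)
Lemma powR_concave x y l th : 0 <= x -> 0 <= y -> 0 <= l <= 1 -> 0 < th <= 1 ->
  (1 - l) * x `^ th + l * y `^ th <= ((1 - l) * x + l * y) `^ th.
Proof.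
move=> x0 y0 /andP[l0 l1] thH; have /andP[th0 th1] := thH.
have l1' : 0 <= 1 - l by rewrite subr_ge0.
set m := (1 - l) * x + l * y.
have := addr_ge0 (mulr_ge0 l1' x0) (mulr_ge0 l0 y0); rewrite -/m le_eqVlt => /predU1P[m0|m0].
  have /eqP := esym m0; rewrite paddr_eq0 ?mulr_ge0// => /andP[/eqP a /eqP b].
  rewrite -m0 powR0 ?gt_eqF//.
  have -> : (1 - l) * x `^ th = 0.
    by move/eqP: a; rewrite mulf_eq0 => /orP[/eqP->|/eqP->]; rewrite ?mul0r// powR0 ?mulr0// gt_eqF.
  have -> : l * y `^ th = 0.
    by move/eqP: b; rewrite mulf_eq0 => /orP[/eqP->|/eqP->]; rewrite ?mul0r// powR0 ?mulr0// gt_eqF.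
  by rewrite addr0.
have E z : 0 <= z -> z `^ th = (z / m) `^ th * m `^ th.
  by move=> z0; rewrite -powRM ?divr_ge0 ?(ltW m0)// divfK// gt_eqF.
rewrite (E x x0) (E y y0) !mulrA -mulrDl ler_piMl ?powR_ge0//.
apply: (@le_trans _ _ ((1 - l) * (th * (x / m) + (1 - th)) + l * (th * (y / m) + (1 - th)))).
  by apply: lerD; apply: ler_wpM2l => //; apply: powR_le_tangent => //; rewrite divr_ge0// ltW.
rewrite [X in X <= _](_ : _ = th * (((1 - l) * x + l * y) / m) + (1 - th)); last first.
  by move: m0; clearbody m => m0; field; rewrite gt_eqF.
by rewrite -/m divff ?gt_eqF// mulr1 addrC subrK.
Qed.

Lemma powR_div x y u : 0 <= x -> 0 <= y -> (x / y) `^ u = x `^ u / y `^ u.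
Proof.
by move=> x0 y0; rewrite powRM ?invr_ge0// -powR_inv1// powRAC powR_inv1 ?powR_ge0.
Qed.

(** The tangent inequality at u = 2 with th = p - 1, whose right-hand side is 1 + (p - 1). *)
Lemma powR2_le p : 1 < p <= 2 -> (2 : R) `^ (p - 1) <= p.
Proof.
move=> /andP[p1 p2]; apply: le_trans (powR_le_tangent _ _) _ => //; last by lra.
by apply/andP; split; lra.
Qed.

End powR_concave.

(** * The Green operator and its weighted estimates *)

Section weight.
Variable R : realType.
Notation mu := (@lebesgue_measure R).
Variables (p T : R).
Hypotheses (T0 : 0 < T) (p1 : 1 < p) (p2 : p <= 2).
Implicit Types (t s c C : R) (g V h : R -> R).

Let p0 : 0 < p. Proof. exact: lt_trans p1. Qed.
Let pm1 : 0 < p - 1 <= 1. Proof. by move: (p1) (p2) => ? ?; apply/andP; split; lra. Qed.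
Let p11 : 0 < p + 1. Proof. by have := p1; lra. Qed.
Let p21' : 1 < 2 * p - 1. Proof. by have := p1; lra. Qed.
Let p21 : 0 < 2 * p - 1. Proof. by have := p1; lra. Qed.
Let p22 : 0 < 2 * p. Proof. by have := p1; lra. Qed.
Let p23 : 0 < 2 * p + 1. Proof. by have := p1; lra. Qed.
Let p24 : 0 < 2 * p + 2. Proof. by have := p1; lra. Qed.

(** The operator with kernel G, without the factor 1/Gamma(p). Its values vanish at t = 0 and t =
    T. *)
Definition green_op g t := frac_int p g t - (t / T) `^ p * frac_int p g T.

(** [b1] and [b2] are the integrals over [0, 1] of s (1 - s)^(p-1) and s (1 - s)^(2p-2). *)
Let b1 : R := (p * (p + 1))^-1.
Let b2 : R := ((2 * p - 1) * (2 * p))^-1.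

(** The function V: t V(t) is exactly the integral of the majorant [L] in [green_op_sq_kernel]. *)
Definition weight_density s : R :=
  2 * (b2 * s `^ (2 * p - 1) - b1 / T * s `^ (2 * p) - (b2 - b1) / T ^+ 2 * s `^ (2 * p + 1)).

Definition weight s := Num.sqrt (s * weight_density s).

(** The truncation moves integrals over [0, t] to the fixed segment [0, T]; for a > 1 the truncated
    kernel is continuous. *)
Let ph a t s : R := (Num.max 0 (t - s)) `^ (a - 1).

Let cph a t : 1 < a -> continuous (ph a t).
Proof.
move=> a1 s.
apply: (@continuous_comp _ _ _ (fun s : R => t - s) (fun x : R => (Num.max 0 x) `^ (a - 1))).
  by apply: cvgB; [exact: cvg_cst|exact: cvg_id].
by apply: continuous_pospowR; rewrite subr_gt0.
Qed.

Let ph_int a t h : 1 < a -> 0 <= t <= T ->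
  \int[mu]_(s in `[0, T]) (ph a t s * h s) = frac_int a h t.
Proof.
move=> a1 /andP[t0 tT]; rewrite frac_intE [LHS]Rintegral_mkcond [RHS]Rintegral_mkcond.
apply: eq_Rintegral => s _; rewrite !patchE !mem_setE !in_itv/= /ph.
have [s0|s0] := leP 0 s => //=; have [st|st] := leP s t.
  by rewrite (le_trans st)// max_r// subr_ge0.
have -> : Num.max 0 (t - s) `^ (a - 1) = 0.
  by rewrite max_l; [rewrite powR0// gt_eqF// subr_gt0|rewrite subr_le0 ltW].
by rewrite mul0r; case: ifP.
Qed.

Let wint h : {within `[0, T], continuous h} -> mu.-integrable `[0, T] (EFin \o h).
Proof. by move=> ch; apply: continuous_compact_integrable => //; exact: segment_compact. Qed.

Let wcX h : {within `[0, T], continuous h} ->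
  {within `[0, T], continuous (fun s => h s ^+ 2)}.
Proof. by move=> ch; exact: (within_continuousM ch ch). Qed.

Let wcC (k : R) : {within `[0, T], continuous (fun _ : R => k : R)}.
Proof. exact: within_continuous_cst. Qed.

Let wcid : {within `[0, T], continuous (fun s : R => s)}.
Proof. exact: within_continuous_id. Qed.

Let wcph a t : 1 < a -> {within `[0, T], continuous (ph a t)}.
Proof. by move=> a1; apply: continuous_subspaceT; exact: cph. Qed.

Let green_opE g t : 0 <= t <= T -> {within `[0, T], continuous g} ->
  green_op g t = \int[mu]_(s in `[0, T]) ((ph p t s - (t / T) `^ p * ph p T s) * g s).
Proof.
move=> tT cg; rewrite /green_op -!(ph_int _ p1)//; last by rewrite lexx ltW.
rewrite -RintegralZl//; last by apply: wint; apply: within_continuousM => //; exact: wcph.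
rewrite -RintegralB//; last 2 first.
- by apply: wint; apply: within_continuousM => //; exact: wcph.
- by apply: wint; do 2 apply: within_continuousM => //; exact: wcph.
by apply: eq_Rintegral => s _; rewrite mulrBl mulrA.
Qed.

Let frac_int_id a t : 0 < a -> 0 < t -> frac_int a id t = t `^ (a + 1) / (a * (a + 1)).
Proof.
move=> a0 t0; have a10 : 0 < a + 1 by rewrite addr_gt0.
have Ga := Gamma_fun_gt0 a0.
transitivity (frac_int a (fun s => s `^ (2 - 1)) t).
  by apply: eq_frac_int => s /andP[s0 _]; rewrite (_ : 2 - 1 = 1); [rewrite powRr1|ring].
rewrite (frac_int_powR a0 _ t0)// (_ : a + 2 = a + 1 + 1); last by ring.
rewrite (Gamma_funD1 a10) (Gamma_funD1 a0) addrK (_ : 2 = 1 + 1 :> R); last by [].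
rewrite (Gamma_funD1 ltr01) Gamma_fun1.
by field; rewrite ?(gt_eqF Ga) ?(gt_eqF a0) ?(gt_eqF a10).
Qed.

(** In the expanded square the product of the two powers has no elementary integral, but it enters
    with a minus sign, so a lower bound suffices. Concavity, applied to T - s as a combination of T
    and T (t - s)/t, gives c1 (t - s)_+^(p-1) + c2 (t - s)_+^(2p-2), and only the moments [b1] and
    [b2] remain. *)
Let green_op_sq_kernel t : 0 < t -> t < T ->
  \int[mu]_(s in `[0, T]) (s * (ph p t s - (t / T) `^ p * ph p T s) ^+ 2) <=
  t * weight_density t.
Proof.
move=> t0 tT; have tT' := ltW tT; have t0' := ltW t0.
have th0 : 0 < p - 1 by rewrite subr_gt0.
have tau1 : 0 <= t / T <= 1 by rewrite divr_ge0 ?(ltW T0)//= ler_pdivrMr ?mul1r.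
have /andP[tau0 _] := tau1.
have q1 := p21'.
have sq u s : ph p u s ^+ 2 = ph (2 * p - 1) u s.
  rewrite /ph -powR_mulrn ?powR_ge0// -powRrM; congr powR; lra.
set k := (t / T) `^ p.
have k0 : 0 <= k by exact: powR_ge0.
pose c1 := (1 - t / T) * T `^ (p - 1).
pose c2 := t / T * (T / t) `^ (p - 1).
have phle s : 0 <= s <= T -> c1 * ph p t s + c2 * ph p t s ^+ 2 <= ph p t s * ph p T s.
  move=> /andP[s0 sT]; have [st|st] := leP t s.
    rewrite /ph max_l ?subr_le0// powR0 ?gt_eqF//.
    by rewrite expr0n/= !mulr0 mul0r addr0.
  have ts : 0 <= t - s by rewrite subr_ge0 ltW.
  rewrite [X in X <= _](_ : _ = ph p t s * (c1 + c2 * ph p t s)); last by ring.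
  rewrite ler_wpM2l ?powR_ge0// /ph !max_r ?subr_ge0 ?(ltW st)//.
  rewrite /c1 /c2 -mulrA -powRM ?divr_ge0 ?(ltW T0)//.
  rewrite (_ : T - s = (1 - t / T) * T + t / T * (T / t * (t - s))); last first.
    by field; rewrite !gt_eqF.
  apply: powR_concave => //; first exact: ltW.
    by rewrite mulr_ge0// divr_ge0// ltW.
have wK : {within `[0, T], continuous (fun s => s * (ph p t s - k * ph p T s) ^+ 2)}.
  apply: within_continuousM => //; apply: wcX; apply: within_continuousB; first exact: wcph.
  by apply: within_continuousM => //; exact: wcph.
pose L s := ph (2 * p - 1) t s * s * (1 - 2 * k * c2) + ph p t s * s * (- (2 * k * c1))
   + ph (2 * p - 1) T s * s * k ^+ 2.
have w1 : {within `[0, T], continuous (fun s => ph (2 * p - 1) t s * s)}.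
  by apply: within_continuousM => //; exact: wcph.
have w2 : {within `[0, T], continuous (fun s => ph p t s * s)}.
  by apply: within_continuousM => //; exact: wcph.
have w3 : {within `[0, T], continuous (fun s => ph (2 * p - 1) T s * s)}.
  by apply: within_continuousM => //; exact: wcph.
have wL : {within `[0, T], continuous L}.
  by apply: within_continuousD; [apply: within_continuousD|]; apply: within_continuousM.
apply: (@le_trans _ _ (\int[mu]_(s in `[0, T]) L s)).
  apply: le_Rintegral => //; [exact: wint|exact: wint|].
  move=> s /=; rewrite in_itv/= => sT; have /andP[s0 _] := sT.
  have := phle s sT; rewrite -subr_ge0 => H.
  rewrite -subr_ge0 /L -!sq.
  rewrite (_ : _ - _ = 2 * k * s * (ph p t s * ph p T s - (c1 * ph p t s + c2 * ph p t s ^+ 2))); last by ring.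
  by rewrite !mulr_ge0.
have iM h c : {within `[0, T], continuous h} ->
    \int[mu]_(s in `[0, T]) (h s * c) = (\int[mu]_(s in `[0, T]) h s) * c.
  by move=> ch; rewrite RintegralZr//; exact: wint.
rewrite /L RintegralD//; try by apply: wint; do ?apply: within_continuousD; apply: within_continuousM.
rewrite RintegralD//; try by apply: wint; apply: within_continuousM.
rewrite !iM// !ph_int ?lexx ?t0' ?(ltW T0)//.
rewrite !frac_int_id//.
have TN : T != 0 by rewrite gt_eqF.
have tN : t != 0 by rewrite gt_eqF.
have x0 : 0 < t `^ p by rewrite powR_gt0.
have y0 : 0 < T `^ p by rewrite powR_gt0.
have pD u a b : 0 < u -> u `^ (a + b) = u `^ a * u `^ b.
  by move=> u0; rewrite powRD// (gt_eqF u0) implybT.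
have pB u : 0 < u -> u `^ (p - 1) = u `^ p / u.
  by move=> u0; rewrite pD// powR_inv1// ltW.
have p2E u : 0 < u -> u `^ (2 * p) = u `^ p ^+ 2.
  by move=> u0; rewrite (_ : 2 * p = p + p) ?pD//; ring.
have kE : k = t `^ p / T `^ p.
  by rewrite /k powR_div// ltW.
have c2E : c2 = t / T * ((T `^ p / T) / (t `^ p / t)).
  by rewrite /c2 powR_div ?(ltW T0)// !pB.
rewrite kE c2E /c1 pB// subrK.
have e1 : t `^ (2 * p - 1) = t `^ p ^+ 2 / t by rewrite pD// powR_inv1 ?p2E// ltW.
have e2 : t `^ (2 * p + 1) = t `^ p ^+ 2 * t by rewrite pD// powRr1 ?p2E// ltW.
have e3 : t `^ (p + 1) = t `^ p * t by rewrite pD// powRr1// ltW.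
rewrite /weight_density e1 e2 e3 !p2E// /b1 /b2.
rewrite le_eqVlt; apply/orP; left; apply/eqP.
have p10 : p + 1 != 0 by rewrite gt_eqF.
have p20 : 2 * p - 1 != 0 by rewrite gt_eqF.
by field; rewrite ?(gt_eqF x0) ?(gt_eqF y0) ?TN ?tN ?p10 ?p20 ?(gt_eqF p0).
Qed.

Let b1_ge0 : 0 < b1. Proof. by rewrite invr_gt0 mulr_gt0 ?addr_gt0. Qed.

Let b2_gt0 : 0 < b2. Proof. by rewrite invr_gt0 mulr_gt0. Qed.

(** The difference is a positive multiple of 2 - p. This inequality gives the sign of V. *)
Let b12 : b1 <= 2 * b2.
Proof.
have h := p21.
rewrite /b1 /b2 -subr_ge0.
rewrite (_ : _ - _ = (2 - p) / ((2 * p - 1) * p * (p + 1))); last first.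
  by field; rewrite ?(gt_eqF h) ?(gt_eqF p0) ?(gt_eqF p11).
apply: divr_ge0; first by rewrite subr_ge0.
by apply: mulr_ge0; [apply: mulr_ge0|]; exact: ltW.
Qed.

(** The factor 1 - s/T reflects that G(T, .) = 0; the last factor is bounded below by b2 (1 -
    s/T). *)
Let weight_densityE s : 0 <= s -> weight_density s =
  2 * s `^ (2 * p - 1) * ((1 - s / T) * (b2 + (b2 - b1) * (s / T))).
Proof.
move=> s0; rewrite /weight_density.
have -> : s `^ (2 * p + 1) = s * s `^ (2 * p).
  by rewrite -(@mulr_powRB1 _ s (2 * p + 1))// addrK.
have -> : s `^ (2 * p) = s * s `^ (2 * p - 1) by rewrite mulr_powRB1.
by field; rewrite gt_eqF.
Qed.

Let weight_density_factor s : 0 <= s <= T ->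
  b2 * (1 - s / T) <= b2 + (b2 - b1) * (s / T).
Proof.
move=> /andP[s0 sT]; rewrite -subr_ge0.
rewrite (_ : _ - _ = (2 * b2 - b1) * (s / T)); last by ring.
apply: mulr_ge0; first by rewrite subr_ge0.
by apply: divr_ge0 => //; exact: ltW.
Qed.

Lemma weight_density_ge0 s : 0 <= s <= T -> 0 <= weight_density s.
Proof.
move=> sT; have /andP[s0 sT'] := sT.
have h : 0 <= 1 - s / T by rewrite subr_ge0 ler_pdivrMr ?mul1r.
rewrite weight_densityE// !mulr_ge0 ?powR_ge0//.
by rewrite (le_trans _ (weight_density_factor sT))// mulr_ge0// ltW.
Qed.

Let weight_density_gt0 s : 0 < s < T -> 0 < weight_density s.
Proof.
move=> /andP[s0 sT].
have h : 0 < 1 - s / T by rewrite subr_gt0 ltr_pdivrMr ?mul1r.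
rewrite weight_densityE ?(ltW s0)// !mulr_gt0 ?powR_gt0//.
rewrite (lt_le_trans _ (weight_density_factor _)) ?(ltW s0) ?(ltW sT)//.
by rewrite mulr_gt0.
Qed.

Let wcpow (a : R) : 0 < a -> {within `[0, T], continuous (fun s : R => s `^ a)}.
Proof. exact: within_continuous_powR. Qed.

Lemma continuous_weight_density : {within `[0, T], continuous weight_density}.
Proof.
have c1 : {within `[0, T], continuous (fun s : R => s `^ (2 * p - 1))} by exact: wcpow.
have c2 : {within `[0, T], continuous (fun s : R => s `^ (2 * p))} by exact: wcpow.
have c3 : {within `[0, T], continuous (fun s : R => s `^ (2 * p + 1))} by exact: wcpow.
by apply: within_continuousM => //; do 2?[apply: within_continuousB]; apply: within_continuousM.
Qed.

Lemma weight_ge0 s : 0 <= weight s.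
Proof. exact: sqrtr_ge0. Qed.

Lemma sqr_weight s : 0 <= s <= T -> weight s ^+ 2 = s * weight_density s.
Proof.
by move=> sT; rewrite sqr_sqrtr// mulr_ge0 ?weight_density_ge0//; case/andP: sT.
Qed.

(** Cauchy-Schwarz for the splitting of G g into s^(1/2) G and s^(-1/2) g. Leaving the majorant [V]
    of g^2/s free covers both the contraction and the first estimate, where g is only O(s^p). *)
Lemma green_op_bound c g V t : 0 < c -> 0 <= t <= T ->
  {within `[0, T], continuous g} -> {within `[0, T], continuous V} ->
  (forall s, 0 <= s <= T -> 0 <= V s) ->
  (forall s, 0 <= s <= T -> g s ^+ 2 <= s * V s) ->
  \int[mu]_(s in `[0, T]) V s <= c ^+ 2 ->
  `|green_op g t| <= c * weight t.
Proof.
move=> c0 tT cg cV V0 gV Vc; have /andP[t0 tT'] := tT.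
have rhs0 : 0 <= c * weight t by rewrite mulr_ge0 ?weight_ge0// ltW.
(* At both end points the weight vanishes, so the quotient [l] below is not usable, but [green_op]
   vanishes too. *)
have [t00|tn0] := eqVneq t 0.
  rewrite {1}t00 /green_op frac_int0 mul0r powR0 ?mul0r ?subrr ?normr0//.
  by rewrite gt_eqF.
have [tTT|tnT] := eqVneq t T.
  by rewrite {1}tTT /green_op divff ?gt_eqF// powR1 mul1r subrr normr0.
have t0' : 0 < t by rewrite lt_neqAle eq_sym tn0.
have ltT : t < T by rewrite lt_neqAle tnT.
have w0 : 0 < weight t by rewrite sqrtr_gt0 mulr_gt0// weight_density_gt0// t0'.
(* The minimiser of l w(t)^2 / 2 + c^2 / (2 l), at which this sum equals c w(t). *)
pose l := c / weight t; have l0 : 0 < l by rewrite divr_gt0.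
rewrite green_opE//.
set K := fun s => ph p t s - (t / T) `^ p * ph p T s.
have wK : {within `[0, T], continuous K}.
  by apply: within_continuousB; [exact: wcph|apply: within_continuousM => //; exact: wcph].
have wsK : {within `[0, T], continuous (fun s => s * K s ^+ 2)}.
  by apply: within_continuousM => //; exact: wcX.
have wKg : {within `[0, T], continuous (fun s => K s * g s)} by exact: within_continuousM.
apply: le_trans (le_normr_Rintegral _ (wint wKg)) _ => //.
apply: (@le_trans _ _ (\int[mu]_(s in `[0, T]) (l / 2 * (s * K s ^+ 2) + (l^-1 / 2) * V s))).
  apply: le_Rintegral => //.
  - exact: integrable_norm (wint wKg).
  - by apply: wint; apply: within_continuousD; apply: within_continuousM.
  move=> s /=; rewrite in_itv/= => sT; have /andP[s0 _] := sT.
  (* Division by s fails at s = 0, where the hypothesis on g^2 forces g(0) = 0. *)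
  have := V0 s sT; have := gV s sT; move: s0; rewrite le_eqVlt => /predU1P[<-|s0].
    rewrite mul0r => g0 v0.
    have -> : g 0 = 0 by apply/eqP; rewrite -sqrf_eq0 eq_le g0 sqr_ge0.
    by rewrite mulr0 normr0 mul0r mulr0 add0r mulr_ge0// divr_ge0// invr_ge0 ltW.
  move=> gs _.
  have ls : 0 < l * s by rewrite mulr_gt0.
  apply: (@le_trans _ _ (l / 2 * (s * K s ^+ 2) + (l^-1 / 2) * (g s ^+ 2 / s))); last first.
    rewrite lerD2l ler_wpM2l ?divr_ge0 ?invr_ge0 ?(ltW l0)//.
    by rewrite ler_pdivrMr// mulrC.
  rewrite -(real_normK (num_real (K s))) -(real_normK (num_real (g s))) normrM.
  rewrite -subr_ge0.
  rewrite (_ : _ - _ = (l * s * `|K s| - `|g s|) ^+ 2 / (2 * (l * s))); last first.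
    by field; rewrite (gt_eqF l0) (gt_eqF s0).
  by rewrite divr_ge0 ?sqr_ge0// mulr_ge0// ltW.
rewrite RintegralD//; last 2 first.
- by apply: wint; apply: within_continuousM.
- by apply: wint; apply: within_continuousM.
rewrite !RintegralZl//; [|exact: wint|exact: wint].
apply: (@le_trans _ _ (l / 2 * (t * weight_density t) + l^-1 / 2 * c ^+ 2)).
  have l2 : 0 <= l / 2 by rewrite divr_ge0// ltW.
  have l2' : 0 <= l^-1 / 2 by rewrite divr_ge0// invr_ge0 ltW.
  by apply: lerD; rewrite ler_wpM2l//; exact: green_op_sq_kernel.
rewrite -sqr_weight// /l le_eqVlt; apply/orP; left; apply/eqP.
by field; rewrite (gt_eqF w0) (gt_eqF c0).
Qed.

Let int_powR b : 0 < b -> \int[mu]_(s in `[0, T]) (s `^ (b - 1)) = T `^ b / b.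
Proof.
move=> b0; have Gb := Gamma_fun_gt0 b0.
rewrite -frac_int_1E (frac_int_powR ltr01 b0 T0) Gamma_fun1 (addrC 1) (Gamma_funD1 b0) addrK.
by field; rewrite (gt_eqF b0) (gt_eqF Gb).
Qed.

(** Since Gamma(p+1) = p Gamma(p), dividing this by Gamma(p) gives [kernel_const], the factor of K
    in Q. *)
Definition contraction_const : R := T `^ p / (2 `^ (2 * p - 1) * p).

Lemma contraction_const_gt0 : 0 < contraction_const.
Proof. by rewrite divr_gt0 ?mulr_gt0 ?powR_gt0. Qed.

Lemma integral_weight_density :
  \int[mu]_(s in `[0, T]) weight_density s <= contraction_const ^+ 2.
Proof.
have c1 : {within `[0, T], continuous (fun s : R => s `^ (2 * p - 1))} by exact: wcpow.
have c2 : {within `[0, T], continuous (fun s : R => s `^ (2 * p))} by exact: wcpow.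
have c3 : {within `[0, T], continuous (fun s : R => s `^ (2 * p + 1))} by exact: wcpow.
rewrite /weight_density RintegralZl//; last first.
  by apply: wint; do 2?[apply: within_continuousB]; apply: within_continuousM.
rewrite RintegralB//; [|by apply: wint; apply: within_continuousB; apply: within_continuousM|by apply: wint; apply: within_continuousM].
rewrite RintegralB//; [|by apply: wint; apply: within_continuousM|by apply: wint; apply: within_continuousM].
rewrite !RintegralZl//; [|by apply: wint..].
rewrite int_powR//.
rewrite (_ : 2 * p = 2 * p + 1 - 1); last by ring.
rewrite int_powR//.
rewrite (_ : 2 * p + 1 - 1 + 1 = 2 * p + 2 - 1); last by ring.
rewrite int_powR//.
rewrite addrK.
have y0 : 0 < T `^ p by rewrite powR_gt0.
have pD a b : T `^ (a + b) = T `^ a * T `^ b by rewrite powRD// (gt_eqF T0) implybT.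
have E2 : T `^ (2 * p) = T `^ p ^+ 2.
  by rewrite -powR_mulrn ?powR_ge0// -powRrM mulrC.
have E3 : T `^ (2 * p + 1) = T `^ p ^+ 2 * T by rewrite pD E2 powRr1// ltW.
have E4 : T `^ (2 * p + 2) = T `^ p ^+ 2 * T ^+ 2 by rewrite pD E2 powR_mulrn// ltW.
rewrite E2 E3 E4.
pose q : R := 2 `^ (p - 1).
have q0 : 0 < q by rewrite powR_gt0.
have qp : q <= p by apply: powR2_le; rewrite p1.
have -> : contraction_const = T `^ p / (2 * q ^+ 2 * p).
  rewrite /contraction_const (_ : 2 * p - 1 = 1 + ((p - 1) + (p - 1))); last by ring.
  have p2D a b : (2 : R) `^ (a + b) = 2 `^ a * 2 `^ b by rewrite powRD// pnatr_eq0 implybT.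
  by rewrite (p2D 1) (p2D (p - 1)) powRr1// -/q expr2.
move: (T `^ p) y0 => y y0.
have y20 : 0 <= y ^+ 2 by exact: sqr_ge0.
have TN := gt_eqF T0; have pN := gt_eqF p0; have p11N := gt_eqF p11.
have p21N := gt_eqF p21; have p23N := gt_eqF p23; have p24N := gt_eqF p24.
pose D := (2 * p - 1) * (2 * p + 1) * (p + 1) ^+ 2.
have D0 : 0 < D by rewrite /D mulr_gt0 ?exprn_gt0// mulr_gt0.
(* As q <= p, c^2 = y^2 / (4 q^4 p^2) is at least y^2 / (4 p^6). This removes the exponential in p
   and leaves a polynomial inequality. *)
apply: (@le_trans _ _ (y ^+ 2 / (4 * p ^+ 6))); last first.
  rewrite exprMn exprVn ler_wpM2l// lef_pV2 ?posrE ?mulr_gt0 ?exprn_gt0 ?mulr_gt0 ?exprn_gt0//.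
  rewrite (_ : (2 * q ^+ 2 * p) ^+ 2 = 4 * (q ^+ 4 * p ^+ 2)); last by ring.
  rewrite (_ : p ^+ 6 = p ^+ 4 * p ^+ 2); last by ring.
  by rewrite ler_wpM2l// ler_wpM2r ?exprn_ge0 ?(ltW p0)// lerXn2r// nnegrE ltW.
rewrite (_ : 2 * _ = y ^+ 2 * ((1 + 5 * p - 2 * p ^+ 2) / (2 * p ^+ 2 * D))); last first.
  by rewrite /D /b1 /b2; field; rewrite TN pN p11N p21N p23N p24N.
rewrite ler_wpM2l// -subr_ge0.
rewrite (_ : _ - _ = (D - 2 * p ^+ 4 * (1 + 5 * p - 2 * p ^+ 2)) / (4 * p ^+ 6 * D)); last first.
  by move: (D) (gt_eqF D0) => d dN; field; rewrite pN dN.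
apply: divr_ge0; last by apply: mulr_ge0; [rewrite mulr_ge0// exprn_ge0// ltW|exact: ltW].
have /andP[x0 x1] := pm1; move/ltW: x0 => x0.
set x := p - 1 in x0 x1.
(* Expanded around p = 1, with 0 <= x <= 1, the polynomial is a sum of nonnegative terms. *)
rewrite (_ : D - _ = 4 + 5 * x + x * (1 - x) + 4 * (x * (1 - x) * (1 + x)) + 12 * x ^+ 4
  + 14 * x ^+ 5 + 4 * x ^+ 6); last by rewrite /D /x; ring.
have x1' : 0 <= 1 - x by rewrite subr_ge0.
have x2' : 0 <= 1 + x by rewrite addr_ge0.
by rewrite !addr_ge0 ?mulr_ge0 ?exprn_ge0.
Qed.

Lemma green_op_contract k g t : 0 < k -> 0 <= t <= T ->
  {within `[0, T], continuous g} ->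
  (forall s, 0 <= s <= T -> `|g s| <= k * weight s) ->
  `|green_op g t| <= k * contraction_const * weight t.
Proof.
move=> k0 tT cg gk.
apply: (@green_op_bound _ g (fun s => k ^+ 2 * weight_density s)) => //.
- by rewrite mulr_gt0// contraction_const_gt0.
- by apply: within_continuousM => //; exact: continuous_weight_density.
- by move=> s sT; rewrite mulr_ge0 ?sqr_ge0// weight_density_ge0.
- move=> s sT; rewrite mulrCA -sqr_weight// -exprMn -(real_normK (num_real (g s))).
  by rewrite lerXn2r ?nnegrE ?gk// mulr_ge0 ?weight_ge0// ltW.
- rewrite RintegralZl//; last by apply: wint; exact: continuous_weight_density.
  by rewrite exprMn ler_wpM2l ?sqr_ge0// integral_weight_density.
Qed.

(** Here g^2/s is at most C^2 s^(2p-1), with integral C^2 T^(2p) / (2p), so one application of the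
    operator leads into the weighted class. *)
Lemma green_op_bound_powR C g t : 0 < C -> 0 <= t <= T ->
  {within `[0, T], continuous g} ->
  (forall s, 0 <= s <= T -> `|g s| <= C * s `^ p) ->
  `|green_op g t| <= C * T `^ p * weight t.
Proof.
move=> C0 tT cg gC.
apply: (@green_op_bound _ g (fun s => C ^+ 2 * s `^ (2 * p - 1))) => //.
- by rewrite mulr_gt0// powR_gt0.
- by apply: within_continuousM => //; exact: wcpow.
- by move=> s sT; rewrite mulr_ge0 ?sqr_ge0// powR_ge0.
- move=> s /[dup] sT /andP[s0 _].
  rewrite mulrCA mulr_powRB1// (_ : s `^ (2 * p) = s `^ p ^+ 2); last first.
    by rewrite -powR_mulrn ?powR_ge0// -powRrM mulrC.
  rewrite -exprMn -(real_normK (num_real (g s))).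
  by rewrite lerXn2r ?nnegrE ?gC// mulr_ge0 ?powR_ge0// ltW.
- rewrite RintegralZl//; last by apply: wint; exact: wcpow.
  rewrite int_powR// exprMn ler_wpM2l ?sqr_ge0//.
  rewrite (_ : T `^ (2 * p) = T `^ p ^+ 2); last by rewrite -powR_mulrn ?powR_ge0// -powRrM mulrC.
  by rewrite ler_pdivrMr// ler_peMr ?sqr_ge0//; have := p21'; rewrite ltrBrDr => /ltW/(le_trans _)->//; rewrite lerDl.
Qed.

(** Both terms of G contribute at most C t^p / p, because (t/T)^p T^p = t^p. *)
Lemma green_op_bound_cst C g t : 0 <= t <= T -> {within `[0, T], continuous g} ->
  (forall s, 0 <= s <= T -> `|g s| <= C) ->
  `|green_op g t| <= 2 / p * C * t `^ p.
Proof.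
move=> /andP[t0 tT] cg gC.
have h u : 0 <= u <= T -> `|frac_int p g u| <= u `^ p / p * C.
  move=> /andP[u0 uT]; apply: frac_int_bound => //.
    exact: subset_within_continuous cg.
  by move=> s /andP[s0 su]; apply: gC; rewrite s0 (le_trans su).
rewrite /green_op (le_trans (ler_normB _ _))//.
rewrite normrM (ger0_norm (powR_ge0 _ _)).
apply: (@le_trans _ _ (t `^ p / p * C + (t / T) `^ p * (T `^ p / p * C))).
  by apply: lerD; [|apply: ler_wpM2l; [exact: powR_ge0|]]; apply: h; rewrite ?t0 ?lexx ?(ltW T0).
have -> : (t / T) `^ p = t `^ p / T `^ p.
  by rewrite powR_div// ltW.
have y0 : 0 < T `^ p by rewrite powR_gt0.
rewrite le_eqVlt; apply/orP; left; apply/eqP.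
by field; rewrite (gt_eqF y0) (gt_eqF p0).
Qed.

End weight.

(** * Nonnegative matrices with spectral radius below 1 *)

Section nonneg_matrix.
Variable R : realType.

(** If r - Q were singular, r would be an eigenvalue of modulus r >= 1. To conclude that the
    supremum is at least r, the set of moduli has to be bounded. *)
Lemma spectral_radius_det (n : nat) (Q : 'M[R]_n) (r : R) :
  spectral_radius Q < 1 -> 1 <= r -> r%:M - Q \in unitmx.
Proof.
move=> Q1 r1; apply: contraT => nunit.
pose A := map_mx (real_complex R) Q.
have normc_ge0 (z : R[i]) : 0 <= ComplexField.Normc.normc z.
  by case: z => a b; rewrite /= sqrtr_ge0.
have eig : eigenvalue A (real_complex R r).
  rewrite /eigenvalue /eigenspace kermx_eq0 /A -map_scalar_mx -map_mxB row_free_map.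
  by rewrite /row_free -mxrank_opp opprB -/(row_free _) row_free_unit.
have [rs rsE] := closed_field_poly_normal (char_poly A).
(* Eigenvalues are roots of the characteristic polynomial, so the sum of the moduli of its roots is
   a bound. *)
have ub : has_ubound [set ComplexField.Normc.normc z | z in [set z | eigenvalue A z]].
  exists (\sum_(z <- rs) ComplexField.Normc.normc z) => _ [z /= + <-].
  rewrite eigenvalue_root_char rsE (monicP (char_poly_monic A)) scale1r root_prod_XsubC.
  elim: rs {rsE} => // w rs ih; rewrite inE big_cons => /predU1P[->|/ih h].
    by rewrite lerDl sumr_ge0.
  by rewrite (le_trans h)// lerDr.
have := ub_le_sup ub (ex_intro2 _ _ (real_complex R r) eig erefl).
rewrite -/(spectral_radius Q) /= expr0n/= addr0 sqrtr_sqr ger0_norm ?(le_trans ler01)//.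
by move=> /(le_trans r1) /le_lt_trans/(_ Q1); rewrite ltxx.
Qed.

(** The M-matrix argument: if the smallest ratio m = x_i/v_i were negative, then (Q x)_i >= m (Q
    v)_i > m r v_i = r x_i, against the hypothesis on x. *)
Lemma nonneg_inverse (n : nat) (Q : 'M[R]_n) (r : R) (v x : 'cV[R]_n) : mxle 0 Q ->
  (forall i, 0 < v i 0) -> (forall i, (Q *m v) i 0 < r * v i 0) ->
  (forall i, 0 <= r * x i 0 - (Q *m x) i 0) -> forall i, 0 <= x i 0.
Proof.
move=> Q0 v0 Qv Qx i0.
have [i _ mini] := @Order.TotalTheory.arg_minP _ _ _ i0 xpredT (fun i => x i 0 / v i 0) isT.
have xv j : x i 0 / v i 0 * v j 0 <= x j 0 by rewrite -ler_pdivlMr// mini.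
rewrite leNgt; apply/negP => xi0.
have m0 : x i 0 / v i 0 < 0.
  rewrite (le_lt_trans (mini i0 isT))//; move: (v0 i0) => vi0.
  by rewrite pmulr_llt0// invr_gt0.
have : (Q *m x) i 0 >= x i 0 / v i 0 * (Q *m v) i 0.
  rewrite !mxE mulr_sumr; apply: ler_sum => j _.
  by rewrite mulrCA ler_wpM2l//; have := Q0 i j; rewrite mxE.
have := Qx i; rewrite subr_ge0 => h1 h2.
have := le_trans h2 h1; rewrite leNgt => /negP; apply.
have -> : r * x i 0 = x i 0 / v i 0 * (r * v i 0).
  by rewrite mulrCA divfK// gt_eqF.
by rewrite ltr_nM2l.
Qed.

Lemma nonneg_supersolution (n : nat) (Q : 'M[R]_n) : mxle 0 Q -> spectral_radius Q < 1 ->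
  exists (v : 'cV[R]_n) (th : R), [/\ 0 <= th < 1, forall i, 0 < v i 0 &
    forall i, (Q *m v) i 0 <= th * v i 0].
Proof.
move=> Q0 Q1.
have Q0' i j : 0 <= Q i j by have := Q0 i j; rewrite mxE.
(* The infimum r0 of S is 1: x = (r - Q)^-1 1 stays bounded as r decreases to r0,
   since r0 - Q is invertible, and Q x = r x - 1 < (r0 - d) x for small d. The
   same x is then the supersolution sought. *)
pose S := [set r : R | 1 <= r /\ exists v : 'cV[R]_n,
  (forall i, 0 < v i 0) /\ forall i, (Q *m v) i 0 < r * v i 0].
have S0 : S !=set0.
  exists (1 + \sum_i \sum_j Q i j); split.
    by rewrite lerDl; apply: sumr_ge0 => i _; apply: sumr_ge0.
  exists (const_mx 1); split=> [i|i]; rewrite !mxE// mulr1.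
  rewrite (eq_bigr (Q i)); last by move=> j _; rewrite mxE mulr1.
  rewrite [X in _ < 1 + X](bigD1 i)//= ltr_pwDl// lerDl.
  by apply: sumr_ge0 => k _; apply: sumr_ge0.
have lbS : lbound S 1 by move=> r [].
have hS : has_inf S by split => //; exists 1.
pose r0 := inf S.
have r01 : 1 <= r0 by exact: lb_le_inf.
pose N := invmx (r0%:M - Q).
(* [C] depends on r0 only, so it bounds x uniformly for r close to r0. *)
pose C := 1 + \sum_i \sum_j `|N i j|.
have C1 : 1 <= C by rewrite lerDl; apply: sumr_ge0 => i _; apply: sumr_ge0.
have C0 : 0 < C by exact: lt_le_trans C1.
(* With s the sum of the entries of x and e = r - r0 <= d, the bound s <= C (1 + e s) gives d s <=
   (1 + d s)/4. Hence d s <= 1/3 and (e + d) x_i < 1 for all i. *)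
pose d := (4 * C)^-1.
have d0 : 0 < d by rewrite invr_gt0 mulr_gt0.
have [r Sr rd] := inf_adherent d0 hS.
have r0r : r0 <= r by apply: ge_inf => //; case: hS.
have [r1 [v [v0 Qv]]] := Sr.
pose x := invmx (r%:M - Q) *m const_mx 1 : 'cV[R]_n.
have xE i : r * x i 0 - (Q *m x) i 0 = 1.
  have : (r%:M - Q) *m x = const_mx 1 by rewrite mulKVmx// spectral_radius_det.
  by move/matrixP/(_ i 0); rewrite mulmxBl mul_scalar_mx !mxE.
clearbody x.
have x0 : forall i, 0 <= x i 0.
  by apply: (nonneg_inverse Q0 v0 Qv) => i; rewrite xE.
have Qx0 i : 0 <= (Q *m x) i 0 by rewrite mxE; apply: sumr_ge0 => j _; rewrite mulr_ge0.
have xpos i : 0 < x i 0.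
  have rx : 0 < r * x i 0 by rewrite (lt_le_trans ltr01)// -(xE i) gerBl.
  by rewrite -(pmulr_rgt0 _ (lt_le_trans ltr01 r1)).
pose e := r - r0.
have e0 : 0 <= e by rewrite subr_ge0.
have ed : e <= d by rewrite lerBlDl ltW.
pose s := \sum_i x i 0.
have s0 : 0 <= s by apply: sumr_ge0.
have xs i : x i 0 <= s.
  by rewrite /s (bigD1 i)//= lerDl; apply: sumr_ge0.
have sC : s <= C * (1 + e * s).
  (* From (r - Q) x = 1 follows (r0 - Q) x = 1 - e x, with 1 the constant vector. *)
  have xN : x = N *m (const_mx 1 - e *: x).
    rewrite -[LHS](mulKmx (spectral_radius_det Q1 r01)) -/N; congr (_ *m _).
    apply/matrixP => i j; rewrite ord1 mulmxBl mul_scalar_mx !mxE -(xE i) /e mxE.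
    ring.
  have xi i : x i 0 <= (\sum_j `|N i j|) * (1 + e * s).
    rewrite {1}xN mxE mulr_suml; apply: ler_sum => j _; rewrite !mxE.
    apply: le_trans (ler_norm _) _; rewrite normrM ler_wpM2l//.
    rewrite (le_trans (ler_normB _ _))// normr1 lerD2l normrM !ger0_norm//.
    by rewrite ler_wpM2l.
  apply: (@le_trans _ _ (\sum_i (\sum_j `|N i j|) * (1 + e * s))).
    by apply: ler_sum => i _.
  by rewrite -mulr_suml ler_wpM2r ?addr_ge0 ?mulr_ge0// /C lerDr.
have dC : d * C = 4^-1 by rewrite /d invfM -mulrA mulVf ?mulr1// gt_eqF.
have ds : d * s <= 3^-1.
  have h1 : d * s <= 4^-1 * (1 + e * s) by rewrite -dC -mulrA ler_wpM2l// ltW.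
  have h2 : e * s <= d * s by rewrite ler_wpM2r.
  lra.
have es : e * s <= 3^-1 by apply: le_trans ds; rewrite ler_wpM2r.
have r0E : r0 = 1.
  apply/eqP; rewrite eq_le r01 andbT leNgt; apply/negP => r0gt.
  have : S (Num.max 1 (r0 - d)).
    split; first by rewrite le_max lexx.
    exists x; split => // i.
    apply: (@lt_le_trans _ _ ((r0 - d) * x i 0)); last first.
      by rewrite ler_wpM2r// le_max lexx orbT.
    have -> : (Q *m x) i 0 = r * x i 0 - 1 by rewrite -(xE i) subKr.
    have h1 : e * x i 0 <= e * s by rewrite ler_wpM2l.
    have h2 : d * x i 0 <= d * s by rewrite ler_wpM2l// ltW.
    have -> : r = r0 + e by rewrite /e addrC subrK.
    lra.
  move=> /(ge_inf hS.2); rewrite -/r0 leNgt gt_max r0gt/= => /negP; apply.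
  by rewrite ltrBlDr ltrDl.
exists x, (1 - d); split => //.
  rewrite subr_ge0 ltrBlDr ltrDl d0 andbT invf_le1 ?mulr_gt0//.
  by rewrite (le_trans C1)// ler_peMl ?(ltW C0) ?ler1n.
move=> i; have -> : (Q *m x) i 0 = r * x i 0 - 1 by rewrite -(xE i) subKr.
have h1 : e * x i 0 <= e * s by rewrite ler_wpM2l.
have h2 : d * x i 0 <= d * s by rewrite ler_wpM2l// ltW.
have -> : r = 1 + e by rewrite /e r0E addrC subrK.
lra.
Qed.

End nonneg_matrix.

(** * Convergence of column vectors by coordinates *)

Section column_vectors.
Variables (R : realType) (n : nat).
Implicit Types (A : set R) (u v : 'cV[R]_n).

Lemma cvg_cV (T : Type) (F : set_system T) (FF : Filter F) (w : T -> 'cV[R]_n) v :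
  (forall i, w x i 0 @[x --> F] --> v i 0) -> w @ F --> v.
Proof.
move=> h P [Q vQ QP]; rewrite /nbhs/=.
have : \forall x \near F, forall i, Q i 0 (w x i 0).
  by apply: filter_forall => i; exact: (h i _ (vQ i 0)).
by apply: filterS => x Qx; apply: QP => i j; rewrite ord1.
Qed.

Lemma within_continuous_cV A (w : R -> 'cV[R]_n) :
  (forall i, {within A, continuous (fun s => w s i 0)}) -> {within A, continuous w}.
Proof. by move=> h x; apply: cvg_cV => i; exact: h. Qed.

Lemma within_continuous_coord A (w : R -> 'cV[R]_n) i :
  {within A, continuous w} -> {within A, continuous (fun s => w s i 0)}.
Proof.
by move=> cw x; apply: (@continuous_comp (subspace A) _ _ w (fun M : 'cV[R]_n => M i 0));
  [exact: cw|exact: coord_continuous].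
Qed.

Lemma uniform_cV A (w : nat -> R -> 'cV[R]_n) (v : R -> 'cV[R]_n) :
  {uniform A, w @ \oo --> v} <->
  forall e : R, 0 < e -> \forall m \near \oo, forall t i, A t -> `|v t i 0 - w m t i 0| < e.
Proof.
split=> [wv e e0|h P].
  have : nbhs (v : {uniform` A -> 'cV[R]_n})
      [set h | forall t, A t -> ball (v t) e (h t)].
    apply/uniform_nbhs; exists [set xy | ball xy.1 e xy.2]; split => //.
    exact: (entourage_ball _ (PosNum e0)).
  move=> /wv nP; apply: (@filterS _ \oo _ (fun m => forall t, A t -> ball (v t) e (w m t)) _ _ nP) => m H t i At.
  by have [_ /(_ i 0)] := H t At.
move=> /uniform_nbhs[E [entE EP]].
have [e e0 eE] : exists2 e : R, 0 < e & [set xy | ball xy.1 e xy.2] `<=` E.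
  by move: entE; rewrite -entourage_ballE => -[e /= e0 eE]; exists e.
apply: (@filterS _ \oo _ (fun m => forall t i, A t -> `|v t i 0 - w m t i 0| < e)
  (fun m => P (w m)) _ (h _ e0)) => m H; apply: EP => t At; apply: eE; split => // i j.
by rewrite ord1; exact: H.
Qed.

End column_vectors.

(** * Sequences with geometrically decreasing increments *)

Section geometric_convergence.
Variable R : realType.

Lemma geometric_increments_cvg (x : nat -> R) (C th : R) : 0 <= th < 1 -> 0 <= C ->
  (forall m, `|x m.+1 - x m| <= C * th ^+ m) ->
  exists l, forall m, `|l - x m| <= C / (1 - th) * th ^+ m.
Proof.
move=> /andP[th0 th1] C0 hx.
have th1' : 0 < 1 - th by rewrite subr_gt0.
have cvx : cvgn x.
  have -> : x = fun m => x 0%N + series (telescope x) m by apply/funext => m; exact: eq_sum_telescope.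
  apply: is_cvgD; first exact: is_cvg_cst.
  apply: normed_cvg; apply: (@series_le_cvg _ _ (geometric C th)) => //.
  - by move=> m /=.
  - by move=> m /=; rewrite mulr_ge0// exprn_ge0.
  - by apply: is_cvg_geometric_series; rewrite ger0_norm.
(* The factor 1 - th^k keeps the exact partial sum of the geometric series, so the induction closes
   with an equality. *)
have hk m k : `|x (m + k)%N - x m| <= C / (1 - th) * th ^+ m * (1 - th ^+ k).
  elim: k => [|k ih]; first by rewrite addn0 subrr normr0 expr0 subrr mulr0.
  rewrite addnS (_ : _ - _ = (x (m + k).+1 - x (m + k)%N) + (x (m + k)%N - x m)); last first.
    by rewrite addrA subrK.
  rewrite (le_trans (ler_normD _ _))// (le_trans (lerD (hx _) ih))//.
  rewrite exprD exprS le_eqVlt; apply/orP; left; apply/eqP.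
  by field; rewrite gt_eqF.
exists (limn x) => m.
have : (fun k => `|x (m + k)%N - x m|) @ \oo --> `|limn x - x m|.
  apply: cvg_norm; apply: cvgB; last exact: cvg_cst.
  have -> : (fun k => x (m + k)%N) = [sequence x (k + m)%N]_k.
    by apply/funext => k; rewrite /= addnC.
  by rewrite (cvg_shiftn m x).
move=> h; rewrite -(cvg_lim (@Rhausdorff R) h); apply: limr_le.
  by apply/cvg_ex; eexists; exact: h.
apply: nearW => k; rewrite (le_trans (hk m k))// ler_piMr//.
  by rewrite mulr_ge0 ?exprn_ge0// divr_ge0// ltW.
by rewrite gerBl exprn_ge0.
Qed.

End geometric_convergence.

(** * Successive approximations, their limit and the determining equation *)

Section approximations.
Variables (R : realType) (n : nat) (T p : R).
Hypotheses (T_gt0 : 0 < T) (p_gt1 : 1 < p) (p_le2 : p <= 2).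
Variables (D : set 'cV[R]_n) (f : R -> 'cV[R]_n -> 'cV[R]_n).
Hypothesis D_closed : closed D.
Hypothesis f_cont :
  {within `[0, T] `*` D, continuous (fun z : R * 'cV[R]_n => f z.1 z.2)}.
Variables (alpha1 alpha2 M : 'cV[R]_n) (K : 'M[R]_n).
Hypothesis K_ge0 : mxle 0 K.
Hypothesis f_bound : forall (t : R) (u : 'cV[R]_n),
  0 <= t <= T -> D u -> mxle (mxabs (f t u)) M.
Hypothesis f_lip : forall (t : R) (u1 u2 : 'cV[R]_n), 0 <= t <= T -> D u1 -> D u2 ->
  mxle (mxabs (f t u1 - f t u2)) (K *m mxabs (u1 - u2)).
Hypothesis Q_lt1 : spectral_radius (Qmx p T K) < 1.
Variable chi : 'cV[R]_n.
Hypothesis approx_in_D : forall (m : nat) (t : R), 0 <= t <= T ->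
  D (u_iter p T f alpha1 alpha2 m t chi).

Notation u m t := (u_iter p T f alpha1 alpha2 m t chi).
Notation uinf t := (u_inf p T f alpha1 alpha2 t chi).
Notation Gp := (Gamma_fun p).
Notation w := (weight p T).

Let T_ge0 : 0 <= T. Proof. exact: ltW. Qed.
Let p_gt0 : 0 < p. Proof. exact: lt_trans p_gt1. Qed.
Let Gp_gt0 : 0 < Gp. Proof. exact: Gamma_fun_gt0. Qed.
Let iGp_ge0 : 0 <= Gp^-1. Proof. by rewrite invr_ge0 ltW. Qed.

Lemma within_continuous_subst (x : R -> 'cV[R]_n) :
  {within `[0, T], continuous x} -> (forall t, 0 <= t <= T -> D (x t)) ->
  {within `[0, T], continuous (fun t : R => f t (x t))}.
Proof.
move=> cx xD; apply/within_continuous_clamp => //.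
apply: (@continuous_comp_within _ _ _ _ (fun z : R * 'cV[R]_n => f z.1 z.2)
  (fun t => (clamp T t, x (clamp T t))) f_cont) => t /=.
  have c1 := @continuous_clamp R T t.
  have c2 := proj1 (within_continuous_clamp x T_ge0) cx t.
  rewrite /continuous_at; exact: (cvg_pair c1 c2).
by rewrite in_itv/= clamp_itv//; split => //; apply: xD; exact: clamp_itv.
Qed.

Lemma vint_scaleE (g : R -> 'cV[R]_n) (t : R) i :
  vint `[0, t]%classic (fun s => ((t - s) `^ (p - 1)) *: g s) i 0 =
  frac_int p (fun s => g s i 0) t.
Proof. by rewrite mxE frac_intE; apply: eq_Rintegral => s _; rewrite mxE. Qed.

Lemma u_iterSE m t i : u m.+1 t i 0 =
  u0 p T alpha1 alpha2 t chi i 0 +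
  Gp^-1 * green_op p T (fun s => f s (u m s) i 0) t.
Proof.
rewrite [LHS]mxE; congr (_ + _); rewrite [LHS]mxE; congr (_ * _).
by rewrite [LHS]mxE vint_scaleE [X in _ + X]mxE [X in _ - X]mxE vint_scaleE.
Qed.

#[local] Opaque u_iter.

Lemma u0E t i : u0 p T alpha1 alpha2 t chi i 0 =
  alpha1 i 0 + t * chi i 0 + (t / T) `^ p * (alpha2 i 0 - alpha1 i 0 - T * chi i 0).
Proof. by rewrite !mxE. Qed.

Let wcpow : {within `[0, T], continuous (fun t : R => (t / T) `^ p)}.
Proof.
apply: (@within_continuous_ext _ _ _ (fun t => t `^ p * (T `^ p)^-1)).
  by move=> t /=; rewrite in_itv/= => /andP[t0 _]; rewrite powR_div.
apply: within_continuousM; [exact: within_continuous_powR|exact: within_continuous_cst].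
Qed.

Lemma continuous_green_op (g : R -> R) : {within `[0, T], continuous g} ->
  {within `[0, T], continuous (green_op p T g)}.
Proof.
move=> cg; apply: within_continuousB; first exact: continuous_frac_int.
by apply: within_continuousM; [exact: wcpow|exact: within_continuous_cst].
Qed.

Lemma continuous_u_iter m : {within `[0, T], continuous (fun t : R => u m t)}.
Proof.
have c0 i : {within `[0, T], continuous (fun t : R => u0 p T alpha1 alpha2 t chi i 0)}.
  apply: (@within_continuous_ext _ _ _ (fun t => alpha1 i 0 + t * chi i 0 +
    (t / T) `^ p * (alpha2 i 0 - alpha1 i 0 - T * chi i 0))).
    by move=> t _; rewrite u0E.
  apply: within_continuousD.
    apply: within_continuousD; first exact: within_continuous_cst.
    by apply: within_continuousM; [exact: within_continuous_id|exact: within_continuous_cst].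
  by apply: within_continuousM; [exact: wcpow|exact: within_continuous_cst].
elim: m => [|m ih].
  by apply: within_continuous_cV => i; exact: c0.
apply: within_continuous_cV => i.
apply: (@within_continuous_ext _ _ _ (fun t => u0 p T alpha1 alpha2 t chi i 0 +
    Gp^-1 * green_op p T (fun s => f s (u m s) i 0) t)).
  by move=> t _; rewrite u_iterSE.
apply: within_continuousD; first exact: c0.
apply: within_continuousM; first exact: within_continuous_cst.
apply: continuous_green_op; apply: within_continuous_coord.
exact: within_continuous_subst ih (approx_in_D m).
Qed.

Lemma continuous_f_coord (x : R -> 'cV[R]_n) i :
  {within `[0, T], continuous x} -> (forall t, 0 <= t <= T -> D (x t)) ->
  {within `[0, T], continuous (fun t : R => f t (x t) i 0)}.
Proof. by move=> cx xD; apply: within_continuous_coord; exact: within_continuous_subst. Qed.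

Lemma continuous_f_u_iter m i : {within `[0, T], continuous (fun t : R => f t (u m t) i 0)}.
Proof.
exact: (@continuous_f_coord (fun t : R => u m t) i (@continuous_u_iter m) (approx_in_D m)).
Qed.

Lemma green_opB (g h : R -> R) t : 0 <= t <= T -> {within `[0, T], continuous g} ->
  {within `[0, T], continuous h} ->
  green_op p T g t - green_op p T h t = green_op p T (fun s => g s - h s) t.
Proof.
move=> /andP[t0 tT] cg ch; rewrite /green_op !frac_intB//; try exact: subset_within_continuous tT _.
move: (frac_int p g t) (frac_int p h t) (frac_int p g T) (frac_int p h T) => a b c d.
ring.
Qed.

Lemma f_lip_coord t (x y : 'cV[R]_n) (v : 'cV[R]_n) (c : R) i : 0 <= t <= T -> D x -> D y ->
  (forall j, `|x j 0 - y j 0| <= c * v j 0) ->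
  `|f t x i 0 - f t y i 0| <= c * (K *m v) i 0.
Proof.
move=> tT Dx Dy h; have := f_lip tT Dx Dy i 0; rewrite !mxE => /le_trans; apply.
rewrite mulr_sumr; apply: ler_sum => j _; rewrite !mxE mulrCA.
by apply: ler_wpM2l => //; have := K_ge0 i j; rewrite mxE.
Qed.

Lemma u_iter_increment m t i : 0 <= t <= T ->
  u m.+2 t i 0 - u m.+1 t i 0 =
  Gp^-1 * green_op p T (fun s => f s (u m.+1 s) i 0 - f s (u m s) i 0) t.
Proof.
move=> tT; etransitivity.
  exact: (congr2 (fun a b => a - b) (u_iterSE m.+1 t i) (u_iterSE m t i)).
rewrite -(green_opB tT (@continuous_f_u_iter m.+1 i) (@continuous_f_u_iter m i)).
by rewrite opprD addrACA subrr add0r -mulrBr.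
Qed.

Let wcdiff m i : {within `[0, T],
  continuous (fun s : R => f s (u m.+1 s) i 0 - f s (u m s) i 0)}.
Proof.
exact: (within_continuousB (@continuous_f_u_iter m.+1 i) (@continuous_f_u_iter m i)).
Qed.

Lemma u_iter_geometric : exists (C : R) (v : 'cV[R]_n) (th : R),
  [/\ 0 < C, 0 <= th < 1, forall i, 0 < v i 0 &
   forall m t i, 0 <= t <= T ->
     `|u m.+2 t i 0 - u m.+1 t i 0| <= C * th ^+ m * v i 0 * w t].
Proof.
have kc0 : 0 <= kernel_const p T.
  apply: divr_ge0; first exact: powR_ge0.
  apply: mulr_ge0; first exact: powR_ge0.
  by apply: ltW; apply: Gamma_fun_gt0; exact: addr_gt0.
have Q0 : mxle 0 (Qmx p T K).
  move=> i j; rewrite !mxE mulr_ge0//; have := K_ge0 i j; by rewrite mxE.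
have [v [th [th01 v0 Qv]]] := nonneg_supersolution Q0 Q_lt1.
have /andP[th0 th1] := th01.
have K0 i j : 0 <= K i j by have := K_ge0 i j; rewrite mxE.
have Kv0 i : 0 <= (K *m v) i 0.
  by rewrite mxE; apply: sumr_ge0 => j _; rewrite mulr_ge0// ltW.
(* The first increment need not vanish at T, so it is only O(t^p); a second
   application of the Green operator brings in the weight. *)
pose C1 : R := Gp^-1 * (2 / p * \sum_i `|M i 0|).
have C10 : 0 <= C1.
  apply: mulr_ge0 => //; apply: mulr_ge0; last by apply: sumr_ge0.
  by rewrite divr_ge0// ltW.
have d1 t i : 0 <= t <= T -> `|u 1 t i 0 - u 0 t i 0| <= C1 * t `^ p.
  move=> tT; rewrite (u_iterSE 0 t i) addrC addKr normrM (ger0_norm iGp_ge0) /C1 -[leRHS]mulrA.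
  apply: (ler_wpM2l iGp_ge0); apply: (green_op_bound_cst T_gt0 p_gt1 tT).
    exact: (@continuous_f_u_iter 0 i).
  move=> s sT; have := f_bound sT (approx_in_D 0 sT) i 0; rewrite mxE => /le_trans; apply.
  rewrite (bigD1 i)//=; apply: le_trans (ler_norm _) _.
  by rewrite lerDl; apply: sumr_ge0.
pose C2 : R := 1 + C1 * \sum_i (K *m (const_mx 1 : 'cV[R]_n)) i 0.
have K10 i : 0 <= (K *m (const_mx 1 : 'cV[R]_n)) i 0.
  by rewrite mxE; apply: sumr_ge0 => j _; rewrite mxE mulr1.
have C20 : 0 < C2.
  by rewrite ltr_pwDl// mulr_ge0//; apply: sumr_ge0.
have d2 t i : 0 <= t <= T -> `|u 2 t i 0 - u 1 t i 0| <= Gp^-1 * (C2 * T `^ p) * w t.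
  move=> tT; rewrite (u_iter_increment 0 i tT) normrM (ger0_norm iGp_ge0) -[leRHS]mulrA.
  apply: (ler_wpM2l iGp_ge0).
  apply: (green_op_bound_powR T_gt0 p_gt1 p_le2 C20 tT (@wcdiff 0 i)) => s sT.
  apply: le_trans (f_lip_coord (v := const_mx 1) (c := C1 * s `^ p) i sT _ _ _) _.
  - exact: approx_in_D.
  - exact: approx_in_D.
  - by move=> j; rewrite [const_mx 1 j 0]mxE mulr1; exact: d1.
  rewrite mulrAC ler_wpM2r ?powR_ge0// /C2 (bigD1 i)//= mulrDr.
  by rewrite addrCA lerDl addr_ge0// mulr_ge0//; apply: sumr_ge0.
(* Summing the inverses of the v_i makes C v_i dominate the bound in [d2] for every coordinate i. *)
pose C : R := 1 + Gp^-1 * (C2 * T `^ p) * \sum_i (v i 0)^-1.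
have iv0 i : 0 <= (v i 0)^-1 by rewrite invr_ge0 ltW.
have A0 : 0 <= Gp^-1 * (C2 * T `^ p)
  by apply: mulr_ge0 => //; apply: mulr_ge0; [exact: ltW|exact: powR_ge0].
have C0 : 0 < C.
  by rewrite ltr_pwDl// mulr_ge0//; apply: sumr_ge0.
exists C, v, th; split => //; elim => [|m ih] t i tT.
  rewrite expr0 mulr1; apply: le_trans (d2 t i tT) _.
  rewrite ler_wpM2r ?weight_ge0// -ler_pdivrMr//.
  rewrite /C (bigD1 i)//= mulrDr addrCA lerDl addr_ge0// mulr_ge0//.
  by apply: sumr_ge0.
rewrite (u_iter_increment m.+1 i tT) normrM (ger0_norm iGp_ge0).
have hg s : 0 <= s <= T ->
    `|f s (u m.+2 s) i 0 - f s (u m.+1 s) i 0| <= C * th ^+ m * (K *m v) i 0 * w s.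
  move=> sT; rewrite mulrAC; apply: f_lip_coord => //; try exact: approx_in_D.
  by move=> j; rewrite mulrAC; exact: ih.
have hk : `|green_op p T (fun s => f s (u m.+2 s) i 0 - f s (u m.+1 s) i 0) t|
    <= C * th ^+ m * (K *m v) i 0 * contraction_const p T * w t.
  have : 0 <= C * th ^+ m * (K *m v) i 0 by rewrite !mulr_ge0 ?exprn_ge0// ltW.
  (* The contraction estimate asks for a positive constant. If the constant is 0, the increment of f
     vanishes on [0, T], and so does its image. *)
  rewrite le_eqVlt => /predU1P[k0|k0]; last first.
    exact: (green_op_contract T_gt0 p_gt1 p_le2 k0 tT (@wcdiff m.+1 i) hg).
  have := @green_op_bound_cst R p T T_gt0 p_gt1 0 _ t tT (@wcdiff m.+1 i).
  rewrite mulr0 mul0r -k0 !mul0r; apply=> s sT.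
  by have := hg s sT; rewrite -k0 mul0r.
apply: le_trans (ler_wpM2l iGp_ge0 hk) _.
(* The constants combine so that K v becomes Q v, to which Q v <= theta v applies. *)
have -> : Gp^-1 * (C * th ^+ m * (K *m v) i 0 * contraction_const p T * w t) =
    C * th ^+ m * w t * (Qmx p T K *m v) i 0.
  have -> : (Qmx p T K *m v) i 0 = kernel_const p T * (K *m v) i 0.
    by rewrite /Qmx -scalemxAl mxE.
  rewrite /kernel_const /contraction_const.
  rewrite (Gamma_funD1 p_gt0).
  have a0 : (2 : R) `^ (2 * p - 1) != 0 by rewrite gt_eqF// powR_gt0.
  by field; rewrite a0 (gt_eqF p_gt0) (gt_eqF Gp_gt0).
rewrite exprSr mulrA [X in _ <= X](_ : _ = C * th ^+ m * w t * (th * v i 0)); last by ring.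
by rewrite ler_wpM2l// !mulr_ge0 ?weight_ge0 ?exprn_ge0// ltW.
Qed.

Lemma weight_bounded : exists2 B, 0 <= B & forall t : R, 0 <= t <= T -> w t <= B.
Proof.
have [B B0 hB] := within_continuous_bounded (within_continuousM
  (@within_continuous_id R `[0, T]%classic) (@continuous_weight_density R p T p_gt1)).
exists (Num.sqrt B); first exact: sqrtr_ge0.
by move=> t tT; apply: ler_wsqrtr; apply: le_trans (hB t tT); exact: ler_norm.
Qed.

Lemma u_iter_uniform_cvg : exists v : R -> 'cV[R]_n,
  {uniform `[0, T]%classic, (fun m s => u m s) @ \oo --> v}.
Proof.
have [C [v [th [C0 th01 v0 hu]]]] := u_iter_geometric.
have /andP[th0 th1] := th01.
have [B B0 wB] := weight_bounded.
pose A i := C * v i 0 * B / (1 - th).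
have A0 i : 0 <= A i.
  by apply: divr_ge0; [apply: mulr_ge0 => //; apply: mulr_ge0; exact: ltW|rewrite subr_ge0 ltW].
have hl t i : 0 <= t <= T -> exists l, forall m, `|l - u m.+1 t i 0| <= A i * th ^+ m.
  move=> tT; apply: (@geometric_increments_cvg _ (fun m => u m.+1 t i 0) (C * v i 0 * B) th th01).
    by apply: mulr_ge0 => //; apply: mulr_ge0; exact: ltW.
  move=> m; apply: le_trans (hu m t i tT) _.
  rewrite [X in _ <= X](_ : _ = C * th ^+ m * v i 0 * B); last by ring.
  apply: ler_wpM2l; last exact: wB.
  by apply: mulr_ge0; [apply: mulr_ge0; [exact: ltW|exact: exprn_ge0]|exact: ltW].
(* The limit is chosen for each t and i; its values outside [0, T] do not affect uniform convergence
   on [0, T]. *)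
pose l t := \col_i (xget 0 [set l | forall m, `|l - u m.+1 t i 0| <= A i * th ^+ m]).
have lP t i m : 0 <= t <= T -> `|l t i 0 - u m.+1 t i 0| <= A i * th ^+ m.
  by move=> tT; rewrite [l t i 0]mxE; have := xgetPex 0 (hl t i tT); apply.
exists l; apply/uniform_cV => e e0.
pose S := \sum_i A i.
have S0 : 0 <= S by apply: sumr_ge0.
have nth : `|th| < 1 by rewrite ger0_norm.
have /cvgr0_norm_lt/(_ e e0)[N _ hN] := cvg_geometric S nth.
(* The geometric bound concerns the approximations from index 1 on, hence the shift. *)
exists N.+1 => // -[//|m] /= Nm t i; rewrite in_itv/= => tT.
apply: le_lt_trans (lP t i m tT) _; apply: le_lt_trans (hN m Nm).
apply: le_trans (ler_norm _); apply: ler_wpM2r; first exact: exprn_ge0.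
by rewrite /S (bigD1 i)//= lerDl; apply: sumr_ge0.
Qed.

(** Uniform limits on [0, T] differ outside the segment; once one exists, [get] returns some limit,
    and only its values on [0, T] are used. *)
Lemma uinf_uniform : {uniform `[0, T]%classic, (fun m s => u m s) @ \oo --> (fun t => uinf t)}.
Proof.
have [v hv] := u_iter_uniform_cvg.
pose S := [set v : R -> 'cV[R]_n |
  {uniform `[0, T]%classic, (fun m s => u m s) @ \oo --> v}].
have : S (get S) by apply: getPex; exists v.
exact.
Qed.

Lemma uinf_close (e : R) : 0 < e -> exists N, forall m (t : R) i, (N <= m)%N -> 0 <= t <= T ->
  `|uinf t i 0 - u m t i 0| < e.
Proof.
move=> e0; have [N _ hN] := proj1 (uniform_cV _ _ _) uinf_uniform e e0.
by exists N => m t i Nm tT; apply: hN => //=; rewrite in_itv.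
Qed.

Lemma uinf_in_D (t : R) : 0 <= t <= T -> D (uinf t).
Proof.
move=> tT; apply: (@closed_cvg _ _ \oo _ (fun m => u m t) D D_closed _ (uinf t)).
  by apply: nearW => m; exact: approx_in_D.
apply: cvg_cV => i; apply/cvgrPdist_lt => e e0.
by have [N hN] := uinf_close e0; exists N => // m /= Nm; exact: hN.
Qed.

Lemma continuous_uinf : {within `[0, T], continuous (fun t : R => uinf t)}.
Proof.
apply: (uniform_limit_continuous_subspace (F := (fun m s => u m s) @ \oo)).
  by exists 0%N => // m _; exact: (@continuous_u_iter m).
exact: uinf_uniform.
Qed.

Lemma continuous_f_uinf i : {within `[0, T], continuous (fun t : R => f t (uinf t) i 0)}.
Proof.
exact: (@continuous_f_coord (fun t : R => uinf t) i continuous_uinf uinf_in_D).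
Qed.

(** The recursion passes to the limit: the Lipschitz condition and the bound for [green_op] turn
    uniform closeness of u_N to the limit into closeness of the right-hand sides. *)
Lemma uinf_fixpoint (t : R) i : 0 <= t <= T -> uinf t i 0 =
  u0 p T alpha1 alpha2 t chi i 0 +
  Gp^-1 * green_op p T (fun s => f s (uinf s) i 0) t.
Proof.
move=> tT; set Y := u0 p T alpha1 alpha2 t chi i 0.
set rhs := Y + _.
pose k := (K *m (const_mx 1 : 'cV[R]_n)) i 0.
have k0 : 0 <= k.
  rewrite /k mxE; apply: sumr_ge0 => j _; rewrite mxE mulr1.
  by have := K_ge0 i j; rewrite mxE.
(* The 1 pays for the distance from the limit to u_(N+1); the other term is the gain of [green_op]
   at t, with k the row sum of K. *)
pose B := 1 + Gp^-1 * (2 / p * k * t `^ p).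
have B0 : 0 < B.
  rewrite ltr_pwDl//; apply: mulr_ge0 => //; apply: mulr_ge0; last exact: powR_ge0.
  by apply: mulr_ge0 => //; rewrite divr_ge0// ltW.
have close e : 0 < e -> `|uinf t i 0 - rhs| <= e * B.
  move=> e0; have [N hN] := uinf_close e0.
  have h1 : `|uinf t i 0 - u N.+1 t i 0| <= e by apply: ltW; apply: hN => //; exact: leqnSn.
  have h2 : `|green_op p T (fun s => f s (u N s) i 0 - f s (uinf s) i 0) t| <= 2 / p * (e * k) * t `^ p.
    apply: (green_op_bound_cst T_gt0 p_gt1 tT).
      exact: (within_continuousB (@continuous_f_u_iter N i) (@continuous_f_uinf i)).
    move=> s sT; apply: f_lip_coord => //; [exact: approx_in_D|exact: uinf_in_D|].
    by move=> j; rewrite mxE mulr1 distrC ltW//; exact: hN.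
  have -> : uinf t i 0 - rhs = (uinf t i 0 - u N.+1 t i 0) + (u N.+1 t i 0 - rhs).
    by rewrite addrA subrK.
  apply: le_trans (ler_normD _ _) _.
  have -> : u N.+1 t i 0 - rhs = Gp^-1 * green_op p T (fun s => f s (u N s) i 0 - f s (uinf s) i 0) t.
    rewrite -(green_opB tT (@continuous_f_u_iter N i) (@continuous_f_uinf i)).
    apply: etrans (congr1 (fun z => z - rhs) (u_iterSE N t i)) _.
    by rewrite /rhs /Y opprD addrACA subrr add0r -mulrBr.
  have -> : e * B = e + Gp^-1 * (2 / p * (e * k) * t `^ p) by rewrite /B; ring.
  by apply: lerD => //; rewrite normrM (ger0_norm iGp_ge0); exact: ler_wpM2l.
apply/eqP; rewrite -subr_eq0 -normr_le0 leNgt; apply/negP => X0.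
(* With e = X / (2 B), a positive distance X would satisfy X <= X / 2. *)
have := close _ (divr_gt0 X0 (mulr_gt0 (ltr0n _ 2) B0)).
set X := `|_| in X0 *.
rewrite (_ : X / (2 * B) * B = X / 2); last by field; rewrite gt_eqF.
by rewrite leNgt ltr_pdivrMr// ltr_pMr// ltr1n.
Qed.

Notation Dl := (Delta_det p T f alpha1 alpha2 chi).

Lemma Delta_detE i : Dl i 0 =
  Gamma_fun (p + 1) / T `^ p * (alpha2 i 0 - alpha1 i 0 - T * chi i 0) -
  p / T `^ p * frac_int p (fun s => f s (uinf s) i 0) T.
Proof.
rewrite [LHS]mxE; congr (_ + _); first by rewrite !mxE.
by rewrite [LHS]mxE; congr (- _); rewrite [LHS]mxE vint_scaleE.
Qed.

(** Delta is built so that Delta t^p / Gamma(p+1) collects all terms of the fixed point equation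
    that carry (t/T)^p. *)
Lemma uinf_frac_int (t : R) i : 0 <= t <= T -> uinf t i 0 =
  alpha1 i 0 + chi i 0 * t + Gp^-1 * frac_int p (fun s => f s (uinf s) i 0 + Dl i 0) t.
Proof.
move=> tT; have /andP[t0 tT'] := tT.
rewrite (uinf_fixpoint i tT) u0E.
have cf := subset_within_continuous tT' (@continuous_f_uinf i).
rewrite (frac_intD p_gt0 cf (@within_continuous_cst R _ _)).
have -> : frac_int p (fun=> Dl i 0) t = t `^ p / p * Dl i 0.
  rewrite mulrC -(frac_int1 p_gt0 t0) -(frac_intZ _ p_gt0 (@within_continuous_cst R _ 1)).
  by apply: eq_frac_int => s _; rewrite mulr1.
rewrite Delta_detE (Gamma_funD1 p_gt0) /green_op (powR_div _ t0 T_ge0).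
have y0 : 0 < T `^ p by rewrite powR_gt0.
move: (frac_int _ _ t) (frac_int _ _ T) (t `^ p) (T `^ p) y0 => a b x y y0.
move: (Gp) Gp_gt0 => G G0.
by field; rewrite (gt_eqF y0) (gt_eqF G0) (gt_eqF p_gt0).
Qed.

Lemma has_caputo_uinf i :
  has_caputo p T (fun t => uinf t i 0) (fun t => f t (uinf t) i 0 + Dl i 0).
Proof.
apply: (@has_caputo_frac_int _ p T (alpha1 i 0) (chi i 0)) => //.
- by rewrite p_gt1.
- exact: (within_continuousD (@continuous_f_uinf i) (@within_continuous_cst R _ _)).
- by move=> t tT; exact: uinf_frac_int.
Qed.

Lemma uinf_bvp_iff :
  bvp_solution p T f alpha1 alpha2 D (fun t : R => uinf t) <-> Dl = 0.
Proof.
have T00 : 0 <= (0 : R) <= T by rewrite lexx.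
have TT0 : 0 <= T <= T by rewrite lexx T_ge0.
split=> [[_ _ hc _ _]|D0].
  apply/matrixP => i j; rewrite ord1 [RHS]mxE.
  (* Delta does not depend on t, so comparing the two Caputo derivatives at t = 0 is enough. *)
  have := has_caputo_unique T_gt0 (hc i) (has_caputo_uinf i) T00.
  by move=> h; apply: (addrI (f 0 (uinf 0) i 0)); rewrite addr0 -h.
split.
- exact: continuous_uinf.
- exact: uinf_in_D.
- move=> i; apply: has_caputo_ext (has_caputo_uinf i) => s _.
  by rewrite D0 mxE addr0.
- apply/matrixP => i j; rewrite ord1 (uinf_fixpoint i T00) u0E /green_op frac_int0.
  by rewrite !mul0r powR0 ?gt_eqF// !mul0r subr0 mulr0 !addr0.
- apply/matrixP => i j; rewrite ord1 (uinf_fixpoint i TT0) u0E /green_op.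
  by rewrite divff ?gt_eqF// powR1 !mul1r subrr mulr0 addr0; ring.
Qed.

End approximations.

Theorem theorem3 (R : realType) (n : nat) (n_ge1 : (1 <= n)%N)
  (T p : R) (T_gt0 : 0 < T) (p_gt1 : 1 < p) (p_le2 : p <= 2)
  (D : set 'cV[R]_n)
  (D_closed : closed D) (D_bounded : bounded_set D) (D_connected : connected D)
  (f : R -> 'cV[R]_n -> 'cV[R]_n)
  (f_cont : {within `[0, T] `*` D, continuous (fun z : R * 'cV[R]_n => f z.1 z.2)})
  (alpha1 alpha2 : 'cV[R]_n) (Omega : set 'cV[R]_n)
  (M : 'cV[R]_n) (K : 'M[R]_n) (K_ge0 : mxle 0 K)
  (f_bound : forall (t : R) (u : 'cV[R]_n), 0 <= t <= T -> D u -> mxle (mxabs (f t u)) M)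
  (f_lip : forall (t : R) (u1 u2 : 'cV[R]_n), 0 <= t <= T -> D u1 -> D u2 ->
     mxle (mxabs (f t u1 - f t u2)) (K *m mxabs (u1 - u2)))
  (Dbeta_neq0 : Dbeta D (beta_vec p T M) !=set0)
  (u0_in_D : forall (t : R) (chi1 : 'cV[R]_n), 0 <= t <= T -> Omega chi1 ->
     D (u0 p T alpha1 alpha2 t chi1))
  (Q_lt1 : spectral_radius (Qmx p T K) < 1)
  (chi1s : 'cV[R]_n) (chi1s_Omega : Omega chi1s)
  (* f is only given on [0, T] x D, so that for the approximations at chi1s to
     be defined they have to take their values in D *)
  (approx_in_D : forall (m : nat) (t : R), 0 <= t <= T ->
     D (u_iter p T f alpha1 alpha2 m t chi1s)) :
  bvp_solution p T f alpha1 alpha2 D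
    (fun t : R => u_inf p T f alpha1 alpha2 t chi1s)
  <-> Delta_det p T f alpha1 alpha2 chi1s = 0.
Proof.
exact: (uinf_bvp_iff T_gt0 p_gt1 p_le2 D_closed f_cont K_ge0 f_bound f_lip Q_lt1
  approx_in_D).
Qed.
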